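(* Let $H$ be a separable infinite-dimensional Hilbert space (real or complex). There exists a dictionary $D$ in $H$ such that for any real sequence $d_n\to0$ which is either strictly monotonic ($d_0>d_1>d_2>\cdots$) or strictly monotonic down to zero ($d_0>d_1>\dots>d_N=0=d_{N+1}=d_{N+2}=\cdots$ for some $N$), there exists an element $x\in H$ with $\sigma_m(x)=d_m$ for all $m=0,1,2,\dots$
   Context: $H$ has norm $|\cdot|$. A dictionary in $H$ is a subset $D$ of the unit sphere of $H$ with $\overline{\mathrm{span}}\,D=H$. For $m\in\mathbb{N}=\{1,2,\dots\}$, $\Sigma_m(D)=\{\sum_{k=1}^m\lambda_kg_k:\ \lambda_k\text{ scalars},\ g_k\in D\}$. For $x\in H$, $\sigma_m(x)=\mathrm{dist}(x,\Sigma_m(D))$ for $m\in\mathbb{N}$, and $\sigma_0(x)=|x|$. *)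

(* Defs.v *)
From mathcomp Require Import all_boot all_order all_algebra.
From mathcomp Require Import all_classical all_reals all_analysis.
From mathcomp Require Import complex.

Set Implicit Arguments.
Unset Strict Implicit.
Unset Printing Implicit Defensive.

Import Order.TTheory GRing.Theory Num.Theory.
Import numFieldNormedType.Exports.

Local Open Scope classical_set_scope.
Local Open Scope ring_scope.

(* [K] is meant to be a [realType] or its complexification [R[i]].  Norms in a
   normed K-module take their values in [K], hence so do the distances below. *)

Definition separable_space (T : topologicalType) : Prop :=
  exists2 S : set T, countable S & dense S.

Definition infinite_dimensional (K : numFieldType) (H : lmodType K) : Prop :=
  ~ exists (n : nat) (e : 'I_n -> H),
      forall x : H, exists c : 'I_n -> K, x = \sum_(k < n) c k *: e k.

(* The [g k] need not be distinct and the [lambda k] may vanish. *)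
Definition Sigma_ (K : numFieldType) (H : lmodType K) (D : set H) (m : nat) :
    set H :=
  [set y | exists (lambda : 'I_m -> K) (g : 'I_m -> H),
     (forall k, D (g k)) /\ y = \sum_(k < m) lambda k *: g k].

Definition linear_span (K : numFieldType) (H : lmodType K) (D : set H) :
    set H :=
  \bigcup_m Sigma_ D m.

Definition dictionary (K : numFieldType) (H : normedModType K) (D : set H) :
    Prop :=
  (forall g, D g -> `|g| = 1) /\ closure (linear_span D) = [set: H].

(* [inf] is only available for a [realType].  The order of [R[i]] compares only
   numbers with equal imaginary parts, so every lower bound of a nonempty set of
   reals is real and [infimum] is the usual infimum of that set of reals. *)
Definition dist_to (K : numFieldType) (H : normedModType K) (x : H)
    (A : set H) : K :=
  infimum 0 [set `|x - a| | a in A].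

Definition sigma_ (K : numFieldType) (H : normedModType K) (D : set H)
    (m : nat) (x : H) : K :=
  if m is 0 then `|x| else dist_to x (Sigma_ D m).

Definition strictly_monotonic (R : realType) (d : nat -> R) : Prop :=
  forall n, d n.+1 < d n.

Definition strictly_monotonic_to_zero (R : realType) (d : nat -> R) : Prop :=
  exists N : nat,
    (forall n, (n < N)%N -> d n.+1 < d n) /\ (forall n, (N <= n)%N -> d n = 0).

(* Main.v *)
Require Import Defs.
From mathcomp Require Import all_boot all_order all_algebra.
From mathcomp Require Import all_classical all_reals all_analysis.
From mathcomp Require Import complex.
From mathcomp Require Import ring lra zify.

Import Order.TTheory GRing.Theory Num.Theory.
Import numFieldNormedType.Exports.

Set Implicit Arguments.
Unset Strict Implicit.
Unset Printing Implicit Defensive.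

Local Open Scope classical_set_scope.
Local Open Scope ring_scope.

(** Let e_n be an orthonormal basis indexed by the nodes n of a forest on nat:
    ancestors of a node are smaller numbers, there are infinitely many roots, and
    every node has infinitely many children.  The dictionary consists of the
    normalised vectors

      g_n = eps_n e_n - sum of eta_n^(n - a) g_a over the strict ancestors a of n,

    where the positive numbers eta_n, and then eps_n, are chosen one node after
    the other, extremely small compared with everything chosen before.  Given d,
    put x_k = sqrt (d_k^2 - d_(k+1)^2) and x = sum x_k e_(b_k) for a suitable
    branch b_0, b_1, ... of the forest.  By triangularity the elements
    g_(b_0), ..., g_(b_(m-1)) span e_(b_0), ..., e_(b_(m-1)), so they approximate
    x with error exactly d_m.  All the work is to show that no other m elements
    do better.

    Let s be another set of m nodes, n its largest element and s' = s - n.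
    If eps_n were 0, then modulo the span of s' the vector g_n would be
    a combination of the ancestors of n outside s', dominated, as eta_n is small,
    by the largest one j.  So s is about as good as s' + j, which consists of
    smaller nodes, and induction applies ([separating_extend]); it yields a strict
    inequality with a margin that absorbs the perturbation ([perturb]), unless
    s' + j is the optimal set itself.  In that case the sign and the size of eps_n
    decide.  If n is not on the branch, the component eps_n e_n is orthogonal to x
    and is a pure loss ([separates_old]).  If n is on the branch, then x has
    positive coefficients in terms of the g_a ([comb_positive]), because
    e_n = (g_n + sum eta_n^(n - a) g_a) / eps_n; so g_n points along -x except for
    eps_n e_n, which points along x, and the two contributions work against each
    other ([separates_newest_used]).

    The parameters have to be chosen before x is known.  This is what the
    infinitely many children are for: the branch is chosen so late in the
    enumeration that 1 / (b_k + 1) <= x_k <= b_k + 1, and then only a bounded set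
    of coordinates matters at each node, which makes every margin uniform
    ([separates]).

    The induction takes place in the polynomials over R, 'X^n playing the role of
    e_n ([prescribed_tails]).  It is carried over to H along an orthonormal basis
    obtained by the Gram-Schmidt process ([exists_frame]); in the complex case the
    imaginary parts of the coefficients only add an error orthogonal to the real
    one ([embed_lower]). *)

(** * Polynomials as finitely supported sequences, and distances to spans *)

Section InnerProduct.
Variable R : realFieldType.
Implicit Types (p q u v w x y z : {poly R}) (vs ws : seq {poly R}).

Definition ip p q := \sum_(i < size p) p`_i * q`_i.
Definition sqn p := ip p p.

Lemma ip_wide n p q : (size p <= n)%N -> ip p q = \sum_(i < n) p`_i * q`_i.
Proof.
move=> le_pn; rewrite /ip (big_ord_widen n (fun i => p`_i * q`_i)) //.
rewrite big_mkcond; apply: eq_bigr => i _; case: ltnP => // le_pi.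
by rewrite nth_default ?mul0r.
Qed.

Lemma ipC p q : ip p q = ip q p.
Proof.
rewrite (@ip_wide (maxn (size p) (size q)) p) ?leq_maxl //.
rewrite (@ip_wide (maxn (size p) (size q)) q) ?leq_maxr //.
by apply: eq_bigr => i _; rewrite mulrC.
Qed.

Lemma ipDr p q q' : ip p (q + q') = ip p q + ip p q'.
Proof. by rewrite /ip -big_split; apply: eq_bigr => i _; rewrite coefD mulrDr. Qed.
Lemma ipZr a p q : ip p (a *: q) = a * ip p q.
Proof. by rewrite /ip mulr_sumr; apply: eq_bigr => i _; rewrite coefZ mulrCA. Qed.
Lemma ipDl p p' q : ip (p + p') q = ip p q + ip p' q.
Proof. by rewrite !(ipC _ q) ipDr. Qed.
Lemma ipZl a p q : ip (a *: p) q = a * ip p q.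
Proof. by rewrite !(ipC _ q) ipZr. Qed.
Lemma ipNr p q : ip p (- q) = - ip p q.
Proof. by rewrite -scaleN1r ipZr mulN1r. Qed.
Lemma ipNl p q : ip (- p) q = - ip p q.
Proof. by rewrite !(ipC _ q) ipNr. Qed.
Lemma ip0r p : ip p 0 = 0. Proof. by have := ipZr 0 p 0; rewrite scale0r mul0r. Qed.
Lemma ip0l p : ip 0 p = 0. Proof. by rewrite ipC ip0r. Qed.
Definition ipE := (ipDl, ipDr, ipNl, ipNr, ipZl, ipZr, ip0l, ip0r).

Lemma ipXn p n : ip p 'X^n = p`_n.
Proof.
rewrite (@ip_wide (maxn (size p) n.+1)) ?leq_maxl //.
have lt_n : (n < maxn (size p) n.+1)%N by rewrite leq_maxr.
rewrite (bigD1 (Ordinal lt_n)) //= coefXn eqxx mulr1 big1 ?addr0 // => i ne_i.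
by rewrite coefXn; case: eqP => [e|]; rewrite ?mulr0 // -val_eqE /= e eqxx in ne_i *.
Qed.

Lemma sqn_ge0 p : 0 <= sqn p.
Proof. by apply: sumr_ge0 => i _; rewrite -expr2 sqr_ge0. Qed.
Lemma sqn_gt0 p : (0 < sqn p) = (p != 0).
Proof.
rewrite lt0r sqn_ge0 andbT; congr negb; apply/eqP/eqP => [|->]; last exact: ip0r.
move/psumr_eq0P => h; apply/polyP => i; rewrite coef0.
case: (ltnP i (size p)) => [lt_i|]; last exact: nth_default.
apply/eqP; rewrite -sqrf_eq0 expr2; apply/eqP.
by apply: (h _ (Ordinal lt_i)) => // k _; rewrite -expr2 sqr_ge0.
Qed.
Lemma sqn_eq0 p : (sqn p == 0) = (p == 0).
Proof. by apply: negb_inj; rewrite -sqn_gt0 lt0r sqn_ge0 andbT. Qed.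

Lemma sqnZ a p : sqn (a *: p) = a ^+ 2 * sqn p.
Proof. by rewrite /sqn !ipE mulrA expr2. Qed.
Lemma sqnD_orth p q : ip p q = 0 -> sqn (p + q) = sqn p + sqn q.
Proof. by move=> pq0; rewrite /sqn !ipE (ipC q) pq0 addr0 add0r. Qed.

Lemma cauchy_schwarz p q : ip p q ^+ 2 <= sqn p * sqn q.
Proof.
have [->|q0] := eqVneq q 0; first by rewrite !ip0r expr0n /= mulr_ge0 ?sqn_ge0.
have q_gt0 : 0 < sqn q by rewrite sqn_gt0.
have := sqn_ge0 (sqn q *: p - ip p q *: q).
rewrite /sqn !ipE -/(sqn p) -/(sqn q) (ipC q p).
move=> h; rewrite -subr_ge0 -(pmulr_rge0 _ q_gt0).
by move: h; congr (_ <= _); ring.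
Qed.

(** Gram-Schmidt elimination: [residual vs x] is x minus its orthogonal projection
    on the span of vs.  A vector of vs that depends on the later ones has residual
    0, and dividing by [sqn 0] = 0 then discards it. *)
Fixpoint residual vs x :=
  if vs is v :: vs' then
    let w := residual vs' v in residual vs' x - (ip (residual vs' x) w / sqn w) *: w
  else x.

Fixpoint spanned vs x : Prop :=
  if vs is v :: vs' then exists c, spanned vs' (x - c *: v) else x = 0.

Lemma residualD vs : {morph residual vs : x y / x + y}.
Proof.
elim: vs => [|v vs IH] x y //=.
by rewrite IH ipDl mulrDl scalerDl opprD addrACA.
Qed.
Lemma residualZ vs a x : residual vs (a *: x) = a *: residual vs x.
Proof.
elim: vs x => [|v vs IH] x //=.
by rewrite IH ipZl -mulrA -scalerA -scalerBr.
Qed.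
Lemma residual0 vs : residual vs 0 = 0.
Proof. by have := residualZ vs 0 0; rewrite !scale0r. Qed.
Lemma residualN vs x : residual vs (- x) = - residual vs x.
Proof. by rewrite -scaleN1r residualZ scaleN1r. Qed.
Lemma residual_sum vs (I : Type) (r : seq I) (P : pred I) (F : I -> {poly R}) :
  residual vs (\sum_(i <- r | P i) F i) = \sum_(i <- r | P i) residual vs (F i).
Proof. exact: (big_morph _ (residualD vs) (residual0 vs)). Qed.

Lemma spanned0 vs : spanned vs 0.
Proof. by elim: vs => [|v vs IH] //=; exists 0; rewrite scale0r subr0. Qed.
Lemma spannedD vs x y : spanned vs x -> spanned vs y -> spanned vs (x + y).
Proof.
elim: vs x y => [|v vs IH] x y /=; first by move=> -> ->; rewrite addr0.
by move=> [c xc] [d yd]; exists (c + d); rewrite scalerDl opprD addrACA; apply: IH.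
Qed.
Lemma spannedZ vs a x : spanned vs x -> spanned vs (a *: x).
Proof.
elim: vs x => [|v vs IH] x /=; first by move=> ->; rewrite scaler0.
by move=> [c xc]; exists (a * c); rewrite -scalerA -scalerBr; apply: IH.
Qed.
Lemma spannedN vs x : spanned vs x -> spanned vs (- x).
Proof. by rewrite -scaleN1r; apply: spannedZ. Qed.
Lemma spanned_sum vs (I : eqType) (r : seq I) (F : I -> {poly R}) :
  (forall i, i \in r -> spanned vs (F i)) -> spanned vs (\sum_(i <- r) F i).
Proof.
by move=> h; rewrite big_seq; apply: big_ind => //; [exact: spanned0|exact: spannedD].
Qed.
Lemma spanned_cons v vs x : spanned vs x -> spanned (v :: vs) x.
Proof. by move=> h /=; exists 0; rewrite scale0r subr0. Qed.
Lemma spanned_mem vs v : v \in vs -> spanned vs v.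
Proof.
elim: vs => [|w vs IH] //=; rewrite inE => /orP[/eqP->|/IH].
  by exists 1; rewrite scale1r subrr; apply: spanned0.
exact: spanned_cons.
Qed.
Lemma spanned_trans vs ws x :
  (forall v, v \in vs -> spanned ws v) -> spanned vs x -> spanned ws x.
Proof.
elim: vs x => [|v vs IH] x /= h; first by move=> ->; apply: spanned0.
case=> c xc; rewrite -(subrK (c *: v) x); apply: spannedD.
  by apply: IH xc => u uvs; apply: h; rewrite inE uvs orbT.
by apply: spannedZ; apply: h; rewrite mem_head.
Qed.

Lemma residual_spanned vs x : spanned vs (x - residual vs x).
Proof.
elim: vs x => [|v vs IH] x /=; first by rewrite subrr.
set c := _ / _; exists c.
have -> : x - (residual vs x - c *: residual vs v) - c *: v =
  (x - residual vs x) - c *: (v - residual vs v) by rewrite scalerBr; ring.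
by apply: spannedD; rewrite // -scaleNr; apply: spannedZ.
Qed.

Lemma residual_orth vs x z : spanned vs z -> ip (residual vs x) z = 0.
Proof.
elim: vs x z => [|v vs IH] x z /=; first by move=> ->; rewrite ip0r.
case=> c zc; set w := residual vs v.
have w_orth y : spanned vs y -> ip w y = 0 by exact: IH.
have x_orth y : spanned vs y -> ip (residual vs x) y = 0 by exact: IH.
have rv : ip (residual vs x) v = ip (residual vs x) w.
  by rewrite -[v in LHS](subrK w) ipDr x_orth ?add0r //; apply: residual_spanned.
have wv : ip w v = sqn w.
  by rewrite -[v in LHS](subrK w) ipDr w_orth ?add0r //; apply: residual_spanned.
rewrite -(subrK (c *: v) z) ipDr !ipDl !ipNl !ipZl !ipZr x_orth // w_orth //.
rewrite rv wv mulr0 subr0 add0r; have [->|w0] := eqVneq w 0.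
  by rewrite /sqn !ip0r !mulr0 subr0.
by rewrite mulrCA divfK ?sqn_eq0 // subrr.
Qed.

Lemma ip_residual vs x y : ip (residual vs x) (residual vs y) = ip x (residual vs y).
Proof.
have := residual_orth y (residual_spanned vs x).
by rewrite ipC ipDl ipNl => /subr0_eq.
Qed.

Lemma residual_min vs x z : spanned vs z -> sqn (residual vs x) <= sqn (x - z).
Proof.
move=> hz; have -> : x - z = residual vs x + ((x - residual vs x) - z) by ring.
rewrite sqnD_orth ?lerDl ?sqn_ge0 //.
by apply: residual_orth; apply: spannedD; [exact: residual_spanned|exact: spannedN].
Qed.

(** The square of the distance from x to a span, and its decrease when v is added.
    All comparisons of sets of nodes below are comparisons of these decreases. *)
Lemma residual_cons v vs x :
  sqn (residual (v :: vs) x) = sqn (residual vs x) - ip x (residual vs v) ^+ 2 / sqn (residual vs v).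
Proof.
rewrite /= ip_residual; set w := residual vs v; set y := residual vs x.
have yw : ip y w = ip x w by rewrite /y ip_residual.
have [->|w0] := eqVneq w 0; first by rewrite scaler0 !ip0r expr0n /= mul0r !subr0.
have w1 : sqn w != 0 by rewrite sqn_eq0.
rewrite {1}/sqn !ipE (ipC w) yw -/(sqn y) -/(sqn w).
by field.
Qed.

Lemma residual_id vs x : (forall v, v \in vs -> ip x v = 0) -> residual vs x = x.
Proof.
elim: vs x => [|v vs IH] x //= h.
have hx : residual vs x = x by apply: IH => u uvs; apply: h; rewrite inE uvs orbT.
rewrite -ip_residual hx {1}hx.
have -> : ip x (residual vs v) = 0.
  by rewrite -ip_residual hx -{1}hx; rewrite ipC ip_residual ipC hx h ?mem_head.
by rewrite mul0r scale0r subr0.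
Qed.

(** Enlarging a span decreases the distance to it; in particular only the span
    of the list matters, not its order or repetitions. *)
Lemma residual_le vs ws x : (forall v, v \in vs -> spanned ws v) ->
  sqn (residual ws x) <= sqn (residual vs x).
Proof.
move=> h; have := residual_min x (spanned_trans h (residual_spanned vs x)).
by rewrite subKr.
Qed.

Lemma residual_contract vs x : sqn (residual vs x) <= sqn x.
Proof. by have := residual_min x (spanned0 vs); rewrite subr0. Qed.

Lemma residual_in vs x : spanned vs x -> residual vs x = 0.
Proof.
move=> h; apply/eqP; rewrite -sqn_eq0 eq_le sqn_ge0 andbT.
by have := residual_min x h; rewrite subrr /sqn ip0r.
Qed.

Lemma residual_eq0_spanned vs x : residual vs x = 0 -> spanned vs x.
Proof. by move=> h; have := residual_spanned vs x; rewrite h subr0. Qed.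

(** The gain [ip x u ^+ 2 / sqn u] depends continuously on the direction u, uniformly
    for x bounded and u bounded and bounded away from 0. *)
Lemma perturb (W B C d : R) : 0 < W -> 0 <= B -> 0 <= C -> 0 < d ->
  exists2 e, 0 < e & forall t, 0 < t -> t < e -> forall u h x,
    W <= sqn u -> sqn u <= C -> sqn h <= C -> sqn x <= B ->
    0 < sqn (u + t *: h) /\
    ip x (u + t *: h) ^+ 2 / sqn (u + t *: h) <= ip x u ^+ 2 / sqn u + d.
Proof.
move=> W0 B0 C0 d0; pose K := 5 * B * C + 2 * C * d + 2 * C + 1.
have BC0 : 0 <= B * C by rewrite mulr_ge0.
have Cd0 : 0 <= C * d by rewrite mulr_ge0 // ltW.
have K0 : 0 < K by rewrite /K; lra.
(* K dominates both constants met below: t * 2 * C < W keeps the new norm positive,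
   and t * (5 * B * C + 2 * C * d) < d * W absorbs all terms of order t. *)
pose e := Num.min 1 (Num.min (W / K) (d * W / K)).
exists e; first by rewrite !lt_min ltr01 !divr_gt0 ?mulr_gt0.
move=> t t0; rewrite !lt_min !ltr_pdivlMr // => /and3P[t1 tW tdW] u h x WD DC HC XB.
have D0 : 0 < sqn u by apply: lt_le_trans WD.
have csx := cauchy_schwarz x u; have csh := cauchy_schwarz x h.
have csu := cauchy_schwarz u h.
have H0 := sqn_ge0 h; have X0 := sqn_ge0 x.
have -> : sqn (u + t *: h) = sqn u + 2 * t * ip u h + t ^+ 2 * sqn h.
  by rewrite /sqn !ipE (ipC h u); ring.
rewrite ipDr ipZr.
move: (ip x u) (ip x h) (ip u h) (sqn u) (sqn h) (sqn x) WD DC HC XB D0 csx csh csu H0 X0.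
move=> a b c D H X WD DC HC XB D0 csx csh csu H0 X0.
have c2 : - (D + C) <= 2 * c.
  suff : - (2 * c) <= D + C by lra.
  have [|c_lt0] := leP 0 c; first by lra.
  rewrite -(@ler_pXn2r _ 2) ?nnegrE //; [|lra|lra].
  have : D * H <= D * C by rewrite ler_pM2l.
  have := sqr_ge0 (D - C); lra.
have Nlow : D - t * (D + C) <= D + 2 * t * c + t ^+ 2 * H.
  have tc : t * - (D + C) <= t * (2 * c) by rewrite ler_pM2l.
  have tH : 0 <= t ^+ 2 * H by rewrite mulr_ge0 ?sqr_ge0.
  lra.
have tC : t * (2 * C) <= t * K by rewrite ler_pM2l // /K; lra.
have tDC : t * D <= t * C by rewrite ler_pM2l.
have Npos : 0 < D - t * (D + C) by lra.
split; first by apply: lt_le_trans Nlow.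
rewrite ler_pdivrMr; last by apply: lt_le_trans Nlow.
apply: (@le_trans _ _ ((a ^+ 2 / D + d) * (D - t * (D + C)))); last first.
  by rewrite ler_wpM2l // addr_ge0 ?divr_ge0 ?sqr_ge0 // ltW.
have a2 : a ^+ 2 / D <= B.
  rewrite ler_pdivrMr //; apply: (le_trans csx).
  by rewrite ler_wpM2r // ltW.
have a20 : 0 <= a ^+ 2 / D by rewrite divr_ge0 ?sqr_ge0 // ltW.
have aE : a ^+ 2 / D * D = a ^+ 2 by rewrite divfK // gt_eqF.
move: (a ^+ 2 / D) a2 a20 aE => al a2 a20 aE.
have a2BC : a ^+ 2 <= B * C by rewrite -aE ler_pM // ltW.
have b2BC : b ^+ 2 <= B * C by apply: (le_trans csh); rewrite ler_pM.
have ab2 : 2 * (a * b) <= a ^+ 2 + b ^+ 2 by have := sqr_ge0 (a - b); lra.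
have lhs : (a + t * b) ^+ 2 <= al * D + t * (3 * B * C).
  have h1 : t * (2 * (a * b)) <= t * (B * C + B * C).
    by rewrite ler_pM2l //; lra.
  have h2 : t * (t * b ^+ 2) <= t * (B * C).
    rewrite ler_pM2l //; apply: (le_trans _ b2BC).
    by rewrite ler_piMl ?sqr_ge0 // ltW.
  by rewrite aE; lra.
have rhs : t * ((D + C) * (al + d)) <= t * (2 * C * (B + d)).
  by rewrite ler_pM2l // ler_pM //; lra.
have dW : d * W <= d * D by rewrite ler_pM2l.
have tC0 : 0 <= t * C by rewrite mulr_ge0 // ltW.
move: tdW; rewrite /K; lra.
Qed.
End InnerProduct.

(** * A forest on the natural numbers with infinite branching *)

(** The parent of n is k when 2 occurs exactly k + 1 times in n, and odd numbers
    (and 0) are roots: every node has infinitely many children, all larger. *)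
Fixpoint anc_rec fuel n : seq nat :=
  if (fuel, logn 2 n) is (f.+1, k.+1) then k :: anc_rec f k else [::].
Definition anc n := anc_rec n n.
Definition lineage n := n :: anc n.

Lemma parent_lt n k : logn 2 n = k.+1 -> (k < n)%N.
Proof.
move=> e; apply: (@leq_trans (logn 2 n)); first by rewrite e.
case: n e => [|n _]; first by rewrite logn0.
by apply/ltnW/ltn_logl.
Qed.

Lemma anc_recE f g n : (n <= f)%N -> (n <= g)%N -> anc_rec f n = anc_rec g n.
Proof.
elim: f g n => [|f IH] g n.
  by rewrite leqn0 => /eqP-> _; case: g => //= g; rewrite logn0.
case: g => [_|g nf ng] /=; first by rewrite leqn0 => /eqP->; rewrite logn0.
case e: (logn 2 n) => [//|k]; have kn := parent_lt e.
by rewrite (IH g) // -ltnS (leq_trans kn).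
Qed.

Lemma ancE n : anc n = if logn 2 n is k.+1 then lineage k else [::].
Proof.
case: n => [|n]; first by rewrite logn0.
rewrite /anc /lineage /=; case e: (logn 2 n.+1) => [//|k].
by have kn := parent_lt e; rewrite /anc (@anc_recE n k).
Qed.

Lemma anc_case n : anc n = [::] \/ exists2 k, (k < n)%N & anc n = lineage k.
Proof.
rewrite ancE; case e: (logn 2 n) => [|k]; first by left.
by right; exists k => //; apply: parent_lt.
Qed.

Lemma anc_ind (P : nat -> Prop) :
  (forall n, anc n = [::] -> P n) ->
  (forall n k, (k < n)%N -> anc n = lineage k -> P k -> P n) -> forall n, P n.
Proof.
move=> P0 PS n; elim: n {-2}n (leqnn n) => [|m IH] n nm.
  apply: P0; case: (anc_case n) => // -[k kn].
  by move: (leq_trans kn nm).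
case: (anc_case n) => [|[k kn e]]; first exact: P0.
by apply: PS (kn) e _; apply: IH; rewrite -ltnS (leq_trans kn).
Qed.

Lemma anc_lt n a : a \in anc n -> (a < n)%N.
Proof.
elim/anc_ind: n => [n -> //|n k kn -> IH].
by rewrite inE => /orP[/eqP->//|/IH ak]; apply: ltn_trans kn.
Qed.

Lemma lineage_le n a : a \in lineage n -> (a <= n)%N.
Proof. by rewrite inE => /orP[/eqP->//|/anc_lt/ltnW]. Qed.

Lemma anc_uniq n : uniq (anc n).
Proof.
elim/anc_ind: n => [n -> //|n k kn -> IH] /=; rewrite IH andbT.
by apply/negP => /anc_lt; rewrite ltnn.
Qed.

Lemma lineage_uniq n : uniq (lineage n).
Proof. by rewrite /= anc_uniq andbT; apply/negP => /anc_lt; rewrite ltnn. Qed.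

Lemma anc_trans n b a : b \in anc n -> a \in lineage b -> a \in anc n.
Proof.
elim/anc_ind: n => [n -> //|n k kn e IH].
rewrite e inE => /orP[/eqP->//|/IH h /h ak].
by rewrite inE ak orbT.
Qed.

Lemma lineage_trans n b a : b \in lineage n -> a \in lineage b -> a \in lineage n.
Proof.
rewrite inE => /orP[/eqP->//|h /(anc_trans h) ah].
by rewrite inE ah orbT.
Qed.

Lemma lineage_lt n p a : (p < n)%N -> a \in lineage p -> (a < n)%N.
Proof. by move=> pn /lineage_le ap; apply: leq_ltn_trans pn. Qed.

(** A new branch can be started, and by [child_above] continued, arbitrarily late
    in the enumeration. *)
Lemma root_above N : exists2 n, (N <= n)%N & anc n = [::].
Proof.
exists N.*2.+1; first by rewrite -addnn; lia.
by rewrite ancE lognE /= dvdn2 /= odd_double.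
Qed.

Lemma child_above k N : exists2 n, (N <= n)%N & anc n = lineage k.
Proof.
exists (2 ^ k.+1 * N.*2.+1)%N.
  have := expn_gt0 2 k.+1; rewrite -muln2; case: (2 ^ k.+1)%N => // m _; nia.
have odd_logn : logn 2 N.*2.+1 = 0%N by rewrite lognE /= dvdn2 /= odd_double.
by rewrite ancE lognM ?expn_gt0 // pfactorK // odd_logn addn0.
Qed.

Lemma lineage_size n : (size (lineage n) <= n.+1)%N.
Proof.
rewrite -(size_iota 0 n.+1); apply: uniq_leq_size; first exact: lineage_uniq.
by move=> a /lineage_le; rewrite mem_iota ltnS.
Qed.

(** * Vectors attached to the nodes *)
Section Tree.
Variable R : realFieldType.
Implicit Types (g : nat -> {poly R}) (y : nat -> R) (s : seq nat).

Definition comb (l : seq nat) y : {poly R} := \sum_(a <- l) y a *: 'X^a.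
(** The square of the distance from [comb (lineage p) y] to the span of the first
    nodes of its branch, up to q. *)
Definition tail q p y : R := \sum_(a <- lineage p | (q < a)%N) y a ^+ 2.
(** Bounds that depend on the node alone: at node p they confine the coordinates
    of a vector on the branch of p to a compact set known in advance. *)
Definition bounded_coefs (p : nat) y :=
  forall a, a \in lineage p -> (a.+1%:R)^-1 <= y a <= a.+1%:R.
(** The part of the vector at n that lies in the span of its ancestors; for small
    eta it is dominated by the nearest ancestor. *)
Definition tilted g n (eta : R) : {poly R} :=
  \sum_(a <- anc n) eta ^+ (n - a) *: g a.
(** The minus sign is essential: it makes 'X^i a combination of the g_a with
    positive coefficients. *)
Definition triangular g n := forall i, (i < n)%N ->
  exists eps eta, [/\ 0 < eps, 0 < eta & g i = eps *: 'X^i - tilted g i eta].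
(** Optimality of the initial segments of the branch of p among all choices of
    nodes below n, with a margin d that does not depend on the vector.  A list s
    may repeat nodes. *)
Definition separates g n d := forall p q s y,
  (p < n)%N -> q \in lineage p -> {in s, forall a, (a < n)%N} ->
  (size s <= size (lineage q))%N -> ~ s =i lineage q -> bounded_coefs p y ->
  tail q p y + d <= sqn (residual (map g s) (comb (lineage p) y)).

Lemma bounded_coefs_gt0 p y a : bounded_coefs p y -> a \in lineage p -> 0 < y a.
Proof. by move=> h /h /andP[/(lt_le_trans _) -> //]; rewrite invr_gt0 ltr0Sn. Qed.

Lemma bounded_coefs_sub p q y :
  bounded_coefs p y -> q \in lineage p -> bounded_coefs q y.
Proof. by move=> h qp a aq; apply: h; apply: lineage_trans aq. Qed.

Lemma coef_comb l y i : uniq l -> (comb l y)`_i = if i \in l then y i else 0.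
Proof.
move=> ul; rewrite /comb coef_sum; case: ifP => il.
  rewrite (bigD1_seq i) //= coefZ coefXn eqxx mulr1 big1 ?addr0 // => a ne.
  by rewrite coefZ coefXn eq_sym (negbTE ne) mulr0.
rewrite big_seq big1 // => a al; rewrite coefZ coefXn.
by case: eqP => [e|]; rewrite ?mulr0 //; rewrite e al in il.
Qed.

Lemma size_comb l y n : {in l, forall a, (a < n)%N} -> (size (comb l y) <= n)%N.
Proof.
move=> h; rewrite /comb big_seq; apply: (big_ind (fun q : {poly R} => size q <= n)%N).
- by rewrite size_poly0.
- by move=> p q hp hq; rewrite (leq_trans (size_polyD _ _)) // geq_max hp.
- move=> a al; apply: (leq_trans (size_scale_leq _ _)).
  by rewrite size_polyXn; apply: h.
Qed.

(** A vector of size at most q + 1 leaves the coordinates beyond q untouched. *)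
Lemma tail_le q p y (z : {poly R}) : (size z <= q.+1)%N ->
  tail q p y <= sqn (comb (lineage p) y - z).
Proof.
move=> zq; set x := comb _ _ - z.
have up := lineage_uniq p; pose N := maxn (size x) p.+1.
rewrite /sqn (@ip_wide _ N) ?leq_maxl //; under eq_bigr do rewrite -expr2.
have lp i : i \in lineage p -> (i < N)%N.
  by move=> /lineage_le ip; rewrite leq_max ltnS ip orbT.
rewrite /tail -[X in X <= _]big_filter /x; move: lp up; move: (lineage p) (N) => l {x}{}N lN ul.
rewrite -(big_mkord xpredT (fun i => (comb l y - z)`_i ^+ 2)) /index_iota subn0.
rewrite [X in _ <= X](bigID (mem [seq a <- l | (q < a)%N])) /=.
rewrite -[X in X <= _]addr0 lerD //; last first.
  by apply: sumr_ge0 => i _; rewrite sqr_ge0.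
rewrite -[X in _ <= X]big_filter.
rewrite [X in _ <= X](perm_big [seq a <- l | (q < a)%N]).
  rewrite le_eqVlt; apply/orP; left; apply/eqP.
  apply: eq_big_seq => i; rewrite mem_filter => /andP[qi il].
  by rewrite coefB coef_comb // il (nth_default _ (leq_trans zq qi)) subr0.
apply: uniq_perm; rewrite ?filter_uniq ?iota_uniq // => i.
rewrite !mem_filter mem_iota /= add0n; case: (q < i)%N => //=.
by case il: (i \in l) => //=; rewrite lN.
Qed.

Lemma size_tilted g n eta : {in anc n, forall a, size (g a) <= a.+1}%N ->
  (size (tilted g n eta) <= n)%N.
Proof.
move=> h; rewrite /tilted big_seq.
apply: (big_ind (fun q : {poly R} => size q <= n)%N).
- by rewrite size_poly0.
- by move=> p q hp hq; rewrite (leq_trans (size_polyD _ _)) // geq_max hp.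
- move=> a al; apply: (leq_trans (size_scale_leq _ _)).
  exact: leq_trans (h a al) (anc_lt al).
Qed.

Lemma triangular_size g n i : triangular g n -> (i < n)%N -> (size (g i) <= i.+1)%N.
Proof.
move=> tri; elim/ltn_ind: i => i IH i_n.
have [eps [eta [_ _ ->]]] := tri i i_n.
rewrite (leq_trans (size_polyD _ _)) // geq_max size_polyN.
rewrite (leq_trans (size_scale_leq _ _)) ?size_polyXn //=.
apply/leqW/size_tilted => a ai; apply: IH; first exact: anc_lt.
exact: ltn_trans (anc_lt ai) i_n.
Qed.

Lemma triangular_coef g n i : triangular g n -> (i < n)%N -> 0 < (g i)`_i.
Proof.
move=> tri i_n; have [eps [eta [eps0 _ ->]]] := tri i i_n.
rewrite coefB coefZ coefXn eqxx mulr1 nth_default ?subr0 //.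
apply/size_tilted => a ai; apply: (triangular_size tri).
exact: ltn_trans (anc_lt ai) i_n.
Qed.

Lemma spanned_size g n s z : triangular g n -> {in s, forall a, (a < n)%N} ->
  spanned (map g s) z -> (size z <= n)%N.
Proof.
move=> tri; elim: s z => [|a s IH] z sn /=; first by move=> ->; rewrite size_poly0.
case=> c /IH h; rewrite -(subrK (c *: g a) z).
have an : (a < n)%N by apply: sn; rewrite mem_head.
rewrite (leq_trans (size_polyD _ _)) // geq_max h => [|b bs]; last first.
  by apply: sn; rewrite inE bs orbT.
rewrite (leq_trans (size_scale_leq _ _)) //.
exact: leq_trans (triangular_size tri an) an.
Qed.

Lemma triangular_sub g m n : (m <= n)%N -> triangular g n -> triangular g m.
Proof. by move=> mn tri i im; apply: tri; apply: leq_trans mn. Qed.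

Lemma triangular_free g n m (c : nat -> R) : triangular g n -> (m <= n)%N ->
  \sum_(i < m) c i *: g i = 0 -> forall i, (i < m)%N -> c i = 0.
Proof.
move=> tri; elim: m => [//|m IH] mn; rewrite big_ord_recr /= => e.
have cm : c m = 0.
  have := congr1 (fun p : {poly R} => p`_m) e.
  rewrite /= coefD coef0 coef_sum big1 => [|i _]; last first.
    rewrite coefZ nth_default ?mulr0 //.
    by apply: leq_trans (triangular_size tri (ltn_trans (ltn_ord i) mn)) _.
  rewrite add0r coefZ => /eqP; rewrite mulf_eq0 => /orP[/eqP //|].
  by rewrite gt_eqF // (triangular_coef tri).
move: e; rewrite cm scale0r addr0 => /(IH (ltnW mn)) h i.
by rewrite ltnS leq_eqVlt => /orP[/eqP->|/h].
Qed.

Lemma spanned_comb g n s z : {in s, forall a, (a < n)%N} -> spanned (map g s) z ->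
  exists c : nat -> R, (forall i, i \notin s -> c i = 0) /\ z = \sum_(i < n) c i *: g i.
Proof.
elim: s z => [|a s IH] z sn /=.
  by move=> ->; exists (fun=> 0); split=> //; rewrite big1 // => i _; rewrite scale0r.
case=> d /IH [b bs|c [cs zc]]; first by apply: sn; rewrite inE bs orbT.
have an : (a < n)%N by apply: sn; rewrite mem_head.
exists (fun i => c i + d * (i == a)%:R); split=> [i|].
  by rewrite inE negb_or => /andP[/negbTE-> /cs ->]; rewrite mulr0 addr0.
under eq_bigr do rewrite scalerDl.
rewrite big_split /= -zc (bigD1 (Ordinal an)) //= eqxx mulr1.
rewrite addrA subrK big1 ?addr0 // => i ne.
by rewrite -val_eqE /= in ne; rewrite (negbTE ne) mulr0 scale0r.
Qed.

(** A vector outside s is at positive distance from the span of s: the leading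
    coefficients make the family free. *)
Lemma triangular_indep g n s j : triangular g n -> {in s, forall a, (a < n)%N} ->
  (j < n)%N -> j \notin s -> 0 < sqn (residual (map g s) (g j)).
Proof.
move=> tri sn jn js; rewrite sqn_gt0; apply/eqP => /residual_eq0_spanned /(spanned_comb sn).
case=> c [cs e].
have e0 : \sum_(i < n) (c i - (i == j :> nat)%:R) *: g i = 0.
  under eq_bigr do rewrite scalerBl.
  rewrite sumrB -e (bigD1 (Ordinal jn)) //= eqxx scale1r big1 ?addr0 ?subrr //.
  by move=> i; rewrite -val_eqE /= => /negbTE->; rewrite scale0r.
have := triangular_free (c := fun i => c i - (i == j)%:R) tri (leqnn n) e0 jn.
by rewrite cs // eqxx sub0r => /eqP; rewrite oppr_eq0 oner_eq0.
Qed.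

Lemma comb_cons k l y : comb (k :: l) y = y k *: 'X^k + comb l y.
Proof. by rewrite /comb big_cons. Qed.

(** Solving [g p = eps *: 'X^p - tilted g p eta] for 'X^p gives positive
    coefficients only, so positive coordinates in the basis 'X^a stay positive in
    terms of the g_a. *)
Lemma comb_positive g n p y : triangular g n -> (p < n)%N ->
  (forall a, a \in lineage p -> 0 < y a) ->
  exists c : nat -> R, (forall a, a \in lineage p -> 0 < c a) /\
    comb (lineage p) y = \sum_(a <- lineage p) c a *: g a.
Proof.
move=> tri; elim/anc_ind: p => [p e|p k kp e IH] pn y0.
  have [eps [eta [eps0 _ gE]]] := tri p pn.
  move: gE y0; rewrite /tilted /lineage e big_nil subr0 => gE y0.
  exists (fun a => y a / eps); split=> [a ap|]; first by rewrite divr_gt0 ?y0.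
  by rewrite /comb !big_seq1 gE scalerA divfK ?gt_eqF.
have [eps [eta [eps0 eta0 gE]]] := tri p pn.
have [a ak|c [c0 cE]] := IH (ltn_trans kp pn).
  by apply: y0; rewrite inE e ak orbT.
have yp : 0 < y p by rewrite y0 ?mem_head.
(* The term y p *: 'X^p contributes y p / eps to g p and, through the tilt,
   eta ^+ (p - a) * (y p / eps) to each strict ancestor a. *)
exists (fun a => (if a == p then 1 else eta ^+ (p - a)) * (y p / eps) + (if a == p then 0 else c a)).
split=> [a|].
  rewrite inE e; case: eqP => [_ _|_ /= /c0 ca]; first by rewrite mul1r addr0 divr_gt0.
  by rewrite addr_gt0 // !mulr_gt0 ?exprn_gt0 ?invr_gt0.
rewrite /lineage comb_cons big_cons eqxx mul1r addr0 e cE.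
have -> : 'X^p = eps^-1 *: (g p + tilted g p eta).
  by rewrite gE subrK scalerA mulVf ?scale1r ?gt_eqF.
rewrite scalerA scalerDr -addrA; congr (_ + _).
rewrite /tilted e scaler_sumr -big_split; apply: eq_big_seq => a ak /=.
have /negbTE-> : a != p.
  by apply/eqP => ap; move: (lineage_lt kp ak); rewrite ap ltnn.
by rewrite scalerA scalerDl mulrC.
Qed.
End Tree.

(** * Choosing the parameters of a new node *)
Section Induction.
Variable R : realFieldType.
Implicit Types (g : nat -> {poly R}) (y : nat -> R) (s : seq nat).

(** There are only finitely many such lists. *)
Lemma finite_lower_bound (f : seq nat -> R) n m :
  exists2 W, 0 < W & forall s, {in s, forall a, (a < n)%N} -> (size s <= m)%N ->
    0 < f s -> W <= f s.
Proof.
elim: m f => [|m IH] f.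
  exists (if 0 < f [::] then f [::] else 1); first by case: ifP.
  by move=> [|//] _ _ ->.
have [W W0 hW] : exists2 W, 0 < W & forall a s, (a < n)%N ->
    {in s, forall a, (a < n)%N} -> (size s <= m)%N -> 0 < f (a :: s) -> W <= f (a :: s).
  suff h k : exists2 W, 0 < W & forall a s, (a < k)%N ->
    {in s, forall a, (a < n)%N} -> (size s <= m)%N -> 0 < f (a :: s) -> W <= f (a :: s).
    exact: h.
  elim: k => [|k [W W0 hW]]; first by exists 1.
  have [V V0 hV] := IH (fun s => f (k :: s)).
  exists (Num.min V W); first by rewrite lt_min V0.
  move=> a s; rewrite ltnS leq_eqVlt ge_min => /orP[/eqP->|ak] sn sm fs.
    by rewrite hV.
  by rewrite hW ?orbT.
exists (Num.min W (if 0 < f [::] then f [::] else 1)).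
  by rewrite lt_min W0 /=; case: ifP.
move=> [|a s] sn sm fs; rewrite ge_min; first by rewrite fs lexx orbT.
by rewrite hW // => [|b bs]; apply: sn; rewrite inE ?eqxx // bs orbT.
Qed.

Lemma sqnD_le (u v : {poly R}) : sqn (u + v) <= 2 * sqn u + 2 * sqn v.
Proof.
have := sqn_ge0 (u - v); rewrite /sqn !ipE (ipC v u); lra.
Qed.

Lemma sum_bounded (F : nat -> {poly R}) l (K : R) :
  exists2 C, 0 <= C & forall c : nat -> R, {in l, forall a, c a ^+ 2 <= K} ->
    sqn (\sum_(a <- l) c a *: F a) <= C.
Proof.
elim: l => [|a l [C C0 IH]].
  by exists 0 => // c _; rewrite big_nil /sqn ip0r.
exists (2 * (Num.max K 0 * sqn (F a)) + 2 * C).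
  by rewrite addr_ge0 ?mulr_ge0 ?sqn_ge0 // le_max lexx orbT.
move=> c hc; rewrite big_cons; apply: (le_trans (sqnD_le _ _)).
apply: lerD; rewrite ler_pM2l //; last first.
  by apply: IH => b bl; apply: hc; rewrite inE bl orbT.
by rewrite sqnZ ler_wpM2r ?sqn_ge0 // le_max hc ?mem_head.
Qed.

Lemma comb_bounded n : exists2 C : R, 0 <= C &
  forall p y, (p < n)%N -> bounded_coefs p y -> sqn (comb (lineage p) y) <= C.
Proof.
elim: n => [|n [C C0 IH]]; first by exists 0.
have [D D0 hD] := sum_bounded (fun a => 'X^a) (lineage n) (n.+1%:R ^+ 2).
exists (Num.max C D); first by rewrite le_max C0.
move=> p y; rewrite ltnS leq_eqVlt le_max => /orP[/eqP->|pn] yp; last by rewrite IH.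
rewrite hD ?orbT // => a an; have /andP[_ ya] := yp a an.
rewrite ler_pXn2r ?nnegrE //; last exact: ltW (bounded_coefs_gt0 yp an).
by apply: (le_trans ya); rewrite ler_nat ltnS lineage_le.
Qed.

(** The ancestor j of n that g_n imitates modulo the span of s. *)
Definition last_missing s n j :=
  [/\ j \in anc n, j \notin s & forall a, a \in anc n -> a \notin s -> (a <= j)%N].

Lemma last_missing_or s n : {subset anc n <= s} \/ exists j, last_missing s n j.
Proof.
case: (boolP (all (mem s) (anc n))) => [/allP h|]; first by left.
rewrite -has_predC => /hasP[a an /= as_]; right.
have ex : exists a, (a \in anc n) && (a \notin s) by exists a; rewrite an.
have ub i : (i \in anc n) && (i \notin s) -> (i <= n)%N.
  by case/andP=> /anc_lt/ltnW.
case: (ex_maxnP ex ub) => j /andP[jn js] jmax; exists j; split=> // b bn bs.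
by apply: jmax; rewrite bn.
Qed.

Definition lower_ancestors g n s j (eta : R) : {poly R} :=
  \sum_(a <- anc n) (if (a \notin s) && (a < j)%N then eta ^+ (j - a.+1) else 0) *: g a.

(** Ancestors of n in s disappear modulo the span of s, and among the others the
    largest one, j, carries the lowest power of eta. *)
Lemma residual_tilted g n eta s j : last_missing s n j ->
  residual (map g s) (tilted g n eta) = eta ^+ (n - j) *:
    (residual (map g s) (g j) + eta *: residual (map g s) (lower_ancestors g n s j eta)).
Proof.
case=> jn js jmax; rewrite /tilted /lower_ancestors !residual_sum.
rewrite (bigD1_seq j) ?anc_uniq //= residualZ scalerDr; congr (_ + _).
rewrite [in RHS](bigD1_seq j) ?anc_uniq //= ltnn andbF scale0r residual0 add0r.
rewrite !scaler_sumr big_seq_cond [RHS]big_seq_cond.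
apply: eq_bigr => a /andP[an aj]; rewrite !residualZ.
case: (boolP (a \in s)) => [as_|as_] /=.
  by rewrite (residual_in (spanned_mem (map_f g as_))) !scaler0.
have {}aj : (a < j)%N by rewrite ltn_neqAle aj jmax.
have jn' := anc_lt jn.
rewrite aj !scalerA -!mulrA -exprS -exprD; congr (_ ^+ _ *: _); lia.
Qed.

(** For small eta, adding the tilted vector to s brings hardly more than adding
    the last missing ancestor j. *)
Lemma tilted_near g n (B d : R) : triangular g n -> 0 <= B -> 0 < d ->
  exists2 e, 0 < e & forall eta, 0 < eta -> eta < e -> forall s j,
    {in s, forall a, (a < n)%N} -> (size s <= n)%N -> last_missing s n j ->
    let u := residual (map g s) (g j) in
    let w := residual (map g s) (tilted g n eta) in
    0 < sqn w /\ forall x, sqn x <= B -> ip x w ^+ 2 / sqn w <= ip x u ^+ 2 / sqn u + d.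
Proof.
move=> tri B0 d0.
(* The pair (j, s') is encoded as the list j :: s' to use [finite_lower_bound]. *)
pose f s := if s is j :: s' then sqn (residual (map g s') (g j)) else 0.
have [W W0 hW] := finite_lower_bound f n n.+1.
have [C C0 hC] := sum_bounded g (anc n) 1.
have [D D0 hD] := sum_bounded g (iota 0 n) 1.
have CD0 : 0 <= Num.max C D by rewrite le_max C0.
have [e e0 he] := perturb W0 B0 CD0 d0.
exists (Num.min e 1); first by rewrite lt_min e0 ltr01.
move=> eta eta0; rewrite lt_min => /andP[eta_e eta1] s j sn sz miss.
have [jn js jmax] := miss; have j_n := anc_lt jn.
rewrite /= (residual_tilted g eta miss); set u := residual _ (g j); set h := residual _ (lower_ancestors _ _ _ _ _).
have Wu : W <= sqn u.
  apply: (hW (j :: s)) => //; last exact: (triangular_indep tri sn).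
  by move=> a; rewrite inE => /orP[/eqP->|/sn].
have uC : sqn u <= Num.max C D.
  rewrite le_max; apply/orP; right; apply: (le_trans (residual_contract _ _)).
  have -> : g j = \sum_(a <- iota 0 n) (a == j)%:R *: g a.
    rewrite (bigD1_seq j) ?iota_uniq ?mem_iota //= eqxx scale1r big1 ?addr0 //.
    by move=> a /negbTE->; rewrite scale0r.
  by apply: hD => a _; case: eqP; rewrite ?expr1n ?expr0n.
have hCD : sqn h <= Num.max C D.
  rewrite le_max; apply/orP; left; apply: (le_trans (residual_contract _ _)).
  apply: hC => a _; case: ifP; rewrite ?expr0n ?ler01 // => _.
  by rewrite exprn_ile1 ?exprn_ge0 ?exprn_ile1 // ltW.
have p0 : 0 < eta ^+ (n - j) by rewrite exprn_gt0.
split=> [|x xB].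
  have x0 : sqn 0 <= B by rewrite /sqn ip0r.
  have [w0 _] := he eta eta0 eta_e u h 0 Wu uC hCD x0.
  by rewrite sqnZ mulr_gt0 ?exprn_gt0.
have [w0 ineq] := he eta eta0 eta_e u h x Wu uC hCD xB.
apply: le_trans ineq; rewrite sqnZ ipZr exprMn -mulf_div divff ?mul1r //.
by rewrite sqrf_eq0 gt_eqF.
Qed.

(** For small eps, adding eps *: 'X^n to the direction w changes the gain only
    slightly. *)
Lemma tip_near g n (v : {poly R}) (B d : R) : 0 <= B -> 0 < d ->
  exists2 e, 0 < e & forall eps, 0 < eps -> eps < e -> forall s,
    {in s, forall a, (a < n)%N} -> (size s <= n)%N ->
    let w := residual (map g s) v in let r := eps *: 'X^n - w in
    0 < sqn w -> forall x, sqn x <= B -> ip x r ^+ 2 / sqn r <= ip x w ^+ 2 / sqn w + d.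
Proof.
move=> B0 d0.
have [W W0 hW] := finite_lower_bound (fun s => sqn (residual (map g s) v)) n n.
have C0 : 0 <= sqn v + 1 by rewrite addr_ge0 ?sqn_ge0.
have [e e0 he] := perturb W0 B0 C0 d0.
exists e => // eps eps0 eps_e s sn sz /= w0 x xB.
have Ww := hW s sn sz w0.
have wC : sqn (residual (map g s) v) <= sqn v + 1.
  by apply: (le_trans (residual_contract _ _)); rewrite lerDl.
have XC : sqn (- 'X^n : {poly R}) <= sqn v + 1.
  by rewrite -scaleN1r sqnZ sqrrN expr1n mul1r /sqn ipXn coefXn eqxx lerDr sqn_ge0.
have [_] := he eps eps0 eps_e _ _ x Ww wC XC xB.
set r := _ + _; have -> : eps *: 'X^n - residual (map g s) v = - r.
  by rewrite /r scalerN opprB.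
by rewrite ipNr sqrrN -scaleN1r sqnZ sqrrN expr1n mul1r.
Qed.
Lemma ip_Xn_small (x : {poly R}) n : (size x <= n)%N -> ip x 'X^n = 0.
Proof. by move=> h; rewrite ipXn nth_default. Qed.

Lemma residual_small g n s (x : {poly R}) : triangular g n -> {in s, forall a, (a < n)%N} ->
  (size x <= n)%N -> (size (residual (map g s) x) <= n)%N.
Proof.
move=> tri sn xn; rewrite -(subKr x (residual _ x)).
rewrite (leq_trans (size_polyD _ _)) // geq_max xn size_polyN.
exact: spanned_size tri sn (residual_spanned _ _).
Qed.

Lemma residual_Xn g n s : triangular g n -> {in s, forall a, (a < n)%N} ->
  residual (map g s) 'X^n = 'X^n.
Proof.
move=> tri sn; apply: residual_id => v /mapP[a as_ ->]; rewrite ipC ip_Xn_small //.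
exact: leq_trans (triangular_size tri (sn a as_)) (sn a as_).
Qed.

Lemma tail_self p y : tail p p y = 0.
Proof.
rewrite /tail big_seq_cond big1 // => a /andP[/lineage_le ap].
by rewrite ltnNge ap.
Qed.

Section Fresh.
Variables (g : nat -> {poly R}) (n : nat) (eps eta : R).
Hypothesis tri : triangular g n.
Hypothesis gE : g n = eps *: 'X^n - tilted g n eta.
Variable s : seq nat.
Hypothesis sn : {in s, forall a, (a < n)%N}.
Let v := tilted g n eta.
Let w := residual (map g s) v.

Lemma tilted_size : (size v <= n)%N.
Proof.
apply: size_tilted => a an; apply: (triangular_size tri); exact: anc_lt.
Qed.

Lemma sqn_residual_unused b (x : {poly R}) : (size x <= n)%N ->
  sqn (residual (map g s) (b *: 'X^n + x)) = b ^+ 2 + sqn (residual (map g s) x).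
Proof.
move=> xn; rewrite residualD residualZ (residual_Xn tri sn) sqnD_orth.
  by rewrite sqnZ /sqn ipXn coefXn eqxx mulr1.
by rewrite ipZl ipC ip_Xn_small ?mulr0 // (residual_small tri).
Qed.

Lemma residual_fresh : residual (map g s) (g n) = eps *: 'X^n - w.
Proof. by rewrite gE residualD residualN residualZ (residual_Xn tri sn). Qed.

Lemma sqn_fresh : sqn (eps *: 'X^n - w) = eps ^+ 2 + sqn w.
Proof.
rewrite sqnD_orth; last first.
  by rewrite ipZl ipNr ipC ip_Xn_small ?oppr0 ?mulr0 // (residual_small tri) // tilted_size.
by rewrite sqnZ /sqn ipXn coefXn eqxx mulr1 -!/(sqn _) -scaleN1r sqnZ sqrrN expr1n mul1r.
Qed.

(** Using the vector at n for a target with coordinate b along 'X^n: the product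
    eps * b competes with the correlation [ip x w] of the tilted part. *)
Lemma sqn_residual_used b (x : {poly R}) : (size x <= n)%N ->
  sqn (residual (g n :: map g s) (b *: 'X^n + x)) =
  b ^+ 2 + sqn (residual (map g s) x) - (eps * b - ip x w) ^+ 2 / (eps ^+ 2 + sqn w).
Proof.
move=> xn; rewrite residual_cons sqn_residual_unused // residual_fresh sqn_fresh; congr (_ - _ ^+ 2 / _).
have XX : ip ('X^n : {poly R}) 'X^n = 1 by rewrite ipXn coefXn eqxx.
have Xw : ip 'X^n w = 0.
  by rewrite ipC ip_Xn_small // (residual_small tri) // tilted_size.
by rewrite !ipE XX Xw ip_Xn_small //; ring.
Qed.
End Fresh.

Lemma fewer_neq_lineage s q : (size s < size (lineage q))%N -> ~ s =i lineage q.
Proof.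
move=> sz e; have sub : {subset lineage q <= s} by move=> a; rewrite e.
by have := uniq_leq_size (lineage_uniq q) sub; rewrite leqNgt sz.
Qed.

(** The direction w, of squared length W, would bring the squared distance Q down to
    no less than T.  A further component of squared length e2, orthogonal to w, that
    does not increase the correlation i2 multiplies the gain by W / (e2 + W), so
    a part of Q - T >= d is kept. *)
Lemma fresh_gain (Q T W V d e2 i2 : R) : 0 < e2 -> 0 <= W -> W <= V -> 0 < d ->
  T + d <= Q -> i2 <= W * (Q - T) -> T + d * e2 / (e2 + V) <= Q - i2 / (e2 + W).
Proof.
move=> e0 W0 WV d0 dQ i2W.
have eW : 0 < e2 + W by lra.
have eV : 0 < e2 + V by lra.
apply: (@le_trans _ _ (T + d * e2 / (e2 + W))).
  rewrite lerD2l ler_pM2l ?mulr_gt0 // lef_pV2 ?posrE //; lra.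
rewrite -subr_ge0.
have -> : Q - i2 / (e2 + W) - (T + d * e2 / (e2 + W)) =
  ((Q - T - d) * e2 + (W * (Q - T) - i2)) / (e2 + W) by field; rewrite gt_eqF.
rewrite divr_ge0 ?(ltW eW) // addr_ge0 ?mulr_ge0 //; lra.
Qed.

(** The inductive step: g n is the new vector, its parameters are small in the
    sense of [near], [tip] and [small], and B bounds all targets. *)
Section Separation.
Variables (g : nat -> {poly R}) (n : nat) (eps eta d B : R).
Hypothesis tri : triangular g n.
Hypotheses (eps0 : 0 < eps) (eta0 : 0 < eta) (d0 : 0 < d).
Hypothesis sep : separates g n d.
Hypothesis gE : g n = eps *: 'X^n - tilted g n eta.
Let v := tilted g n eta.
Let slack := Num.min (d / 4) (2 * n.+1%:R ^+ 2)^-1.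
Hypothesis combB : forall p y, (p < n.+1)%N -> bounded_coefs p y ->
  sqn (comb (lineage p) y) <= B.
Hypothesis near : forall s j,
  {in s, forall a, (a < n)%N} -> (size s <= n)%N -> last_missing s n j ->
  let u := residual (map g s) (g j) in
  let w := residual (map g s) v in
  0 < sqn w /\ forall x, sqn x <= B -> ip x w ^+ 2 / sqn w <= ip x u ^+ 2 / sqn u + d / 2.
Hypothesis tip : forall s,
  {in s, forall a, (a < n)%N} -> (size s <= n)%N ->
  let w := residual (map g s) v in let r := eps *: 'X^n - w in
  0 < sqn w -> forall x, sqn x <= B -> ip x r ^+ 2 / sqn r <= ip x w ^+ 2 / sqn w + slack.
Hypothesis small : forall s,
  {in s, forall a, (a < n)%N} -> (size s <= n)%N ->
  let w := residual (map g s) v in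
  0 < sqn w -> (eps * n.+1%:R) ^+ 2 <= d * sqn w.

Let gain := d * eps ^+ 2 / (eps ^+ 2 + sqn v).

(** Fewer nodes than the initial segment has can never form it. *)
Lemma separates_fewer s p q y : (p < n)%N -> q \in lineage p -> {in s, forall a, (a < n)%N} ->
  (size s < size (lineage q))%N -> bounded_coefs p y ->
  tail q p y + d <= sqn (residual (map g s) (comb (lineage p) y)).
Proof.
move=> pn qp sn sz yp; apply: sep => //; first exact: ltnW.
exact: fewer_neq_lineage.
Qed.

(** Replacing the last missing ancestor j by the tilted vector costs at most half of
    the margin, as long as j does not complete s to the optimal set. *)
Lemma exchange s p q j y : (p < n)%N -> q \in lineage p -> {in s, forall a, (a < n)%N} ->
  (size s < size (lineage q))%N -> bounded_coefs p y -> last_missing s n j ->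
  ~ j :: s =i lineage q ->
  let w := residual (map g s) v in let x := comb (lineage p) y in
  0 < sqn w /\ tail q p y + d / 2 <= sqn (residual (map g s) x) - ip x w ^+ 2 / sqn w.
Proof.
move=> pn qp sn sz yp miss ne w x.
have [jn _ _] := miss.
have szn : (size s <= n)%N.
  rewrite -ltnS (leq_trans sz) // (leq_trans (lineage_size q)) // ltnS ltnW //.
  exact: lineage_lt pn qp.
have [w0 hw] := near sn szn miss; split=> //.
have jsn : {in j :: s, forall a, (a < n)%N}.
  by move=> a; rewrite inE => /orP[/eqP->|/sn //]; apply: anc_lt.
have h1 := sep pn qp jsn sz ne yp.
rewrite [map _ _]/= residual_cons in h1.
have h2 := hw x (combB (ltnW pn) yp).
rewrite -/w -/x in h1 h2; lra.
Qed.

(** Targets whose branch does not contain n.  The tilted part alone cannot reach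
    below the tail: by [exchange]; or, when j completes s to the optimal set, because
    all ancestors of n are then at most q; or because no ancestor is missing in s and
    it adds nothing.  The component
    along 'X^n is orthogonal to the target, so that [fresh_gain] applies. *)
Lemma separates_old s p q y : (p < n)%N -> q \in lineage p -> {in s, forall a, (a < n)%N} ->
  (size s < size (lineage q))%N -> bounded_coefs p y ->
  tail q p y + gain <= sqn (residual (g n :: map g s) (comb (lineage p) y)).
Proof.
move=> pn qp sn sz yp; set x := comb _ _.
have xn : (size x <= n)%N by apply: size_comb => a /lineage_lt; apply.
have := sqn_residual_used tri gE sn 0 xn.
rewrite scale0r add0r expr0n /= add0r mulr0 sub0r sqrrN => ->.
rewrite -/v; set w := residual (map g s) v; have h1 := separates_fewer pn qp sn sz yp; rewrite -/x in h1.
apply: fresh_gain => //; [exact: exprn_gt0|exact: sqn_ge0|exact: residual_contract|].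
suff bound : tail q p y <= sqn (residual (map g s) x) - ip x w ^+ 2 / sqn w.
  have [w0|w_gt0] := eqVneq (sqn w) 0.
    have w0' : w = 0 by apply/eqP; rewrite -sqn_eq0 w0.
    by rewrite w0' ip0r expr0n /sqn ip0r mul0r.
  have {}w_gt0 : 0 < sqn w by rewrite lt0r w_gt0 sqn_ge0.
  by rewrite mulrC -ler_pdivrMr //; lra.
have [sub|[j miss]] := last_missing_or s n.
  have -> : w = 0.
    by apply/residual_in/spanned_sum => a an; apply/spannedZ/spanned_mem/map_f/sub.
  by rewrite ip0r expr2 !mul0r subr0; move: h1 d0; lra.
have [e|ne] := pselect (j :: s =i lineage q); last first.
  by have [_] := exchange pn qp sn sz yp miss ne; rewrite -/w -/x; move: d0; lra.
have [jn js jmax] := miss.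
have sq a : a \in s -> (a < q.+1)%N.
  by move=> as_; rewrite ltnS lineage_le // -e inE as_ orbT.
(* Here j completes s to the lineage of q.  An ancestor of n is in s or at most j, hence
   at most q, so everything spanned by s and v has size at most q + 1. *)
have jq : (j < q.+1)%N by rewrite ltnS lineage_le // -e mem_head.
have qn : (q.+1 <= n)%N by exact: lineage_lt pn qp.
rewrite -residual_cons -[residual _ _]opprK opprK.
set z := x - residual (v :: map g s) x.
have -> : residual (v :: map g s) x = x - z by rewrite /z subKr.
apply: tail_le.
have [c hc] := residual_spanned (v :: map g s) x.
have vq : (size v <= q.+1)%N.
  rewrite /v /tilted big_seq.
  apply: (big_ind (fun r : {poly R} => size r <= q.+1)%N).
  - by rewrite size_poly0.
  - by move=> r r' hr hr'; rewrite (leq_trans (size_polyD _ _)) // geq_max hr.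
  - move=> a an; apply: (leq_trans (size_scale_leq _ _)).
    apply: (leq_trans (triangular_size tri (anc_lt an))).
    case: (boolP (a \in s)) => [/sq //|as_]; rewrite ltnS.
    by apply: (leq_trans (jmax a an as_)).
rewrite -/z -(subrK (c *: v) z) (leq_trans (size_polyD _ _)) // geq_max.
rewrite (leq_trans (size_scale_leq _ _)) // andbT.
exact: spanned_size (triangular_sub qn tri) sq hc.
Qed.

Lemma slack_le : slack <= d / 4. Proof. by rewrite /slack ge_min lexx. Qed.

Lemma slack_le_newest y : bounded_coefs n y -> slack * 2 <= y n ^+ 2.
Proof.
move=> yn; have /andP[y1 _] := yn n (mem_head _ _).
apply: (@le_trans _ _ ((n.+1%:R)^-1 ^+ 2)); last first.
  by rewrite ler_pXn2r ?nnegrE ?invr_ge0 ?ler0n // ltW // (bounded_coefs_gt0 yn) ?mem_head.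
have : slack <= (2 * n.+1%:R ^+ 2)^-1 by rewrite /slack ge_min lexx orbT.
by rewrite invfM exprVn mulrC ler_pdivlMr ?ltr0n // mulrC.
Qed.

Lemma tail_parent q k y : anc n = lineage k -> q \in lineage k ->
  tail q n y = y n ^+ 2 + tail q k y.
Proof.
move=> e qk; rewrite /tail [lineage n]/lineage big_cons -e.
by rewrite anc_lt // e.
Qed.

Lemma comb_parent y : comb (lineage n) y = y n *: 'X^n + comb (anc n) y.
Proof. exact: comb_cons. Qed.

Lemma comb_anc_size y : (size (comb (anc n) y) <= n)%N.
Proof. by apply: size_comb => a; apply: anc_lt. Qed.

Lemma anc_parent q : q \in anc n -> exists2 k, (k < n)%N & anc n = lineage k.
Proof. by case: (anc_case n) => [->|]. Qed.

Lemma bounded_parent k y : anc n = lineage k -> bounded_coefs n y -> bounded_coefs k y.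
Proof.
by move=> e yn; apply: (bounded_coefs_sub yn); rewrite inE e mem_head orbT.
Qed.

Lemma separates_newest_unused s q y : q \in lineage n -> {in s, forall a, (a < n)%N} ->
  (size s <= size (lineage q))%N -> ~ s =i lineage q -> bounded_coefs n y ->
  tail q n y + slack <= sqn (residual (map g s) (comb (lineage n) y)).
Proof.
move=> qn sn sz ne yn; rewrite comb_parent (sqn_residual_unused tri sn) ?comb_anc_size //.
have y2 := slack_le_newest yn; have := slack_le; have := d0.
move: qn; rewrite inE => /orP[/eqP qn|qn].
  rewrite qn tail_self; have := sqn_ge0 (residual (map g s) (comb (anc n) y)).
  by have := sqr_ge0 (y n); lra.
have [k kn e] := anc_parent qn; rewrite e in qn.
rewrite (tail_parent _ e) //.
have := sep kn qn sn sz ne (bounded_parent e yn); rewrite e; lra.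
Qed.

(** When j completes s to the whole lineage, only g_j survives modulo s, both in the
    target and in the tilted vector; the coefficients of g_j in both are positive. *)
Lemma residual_aligned s k j y : anc n = lineage k -> (k < n)%N -> {in s, forall a, (a < n)%N} ->
  last_missing s n j -> j :: s =i lineage k -> bounded_coefs k y ->
  exists2 c, 0 < c & residual (map g s) (comb (lineage k) y) = c *: residual (map g s) v.
Proof.
move=> e kn sn [jn js jmax] js_k yk.
have residual_s a : a \in anc n -> a != j -> residual (map g s) (g a) = 0.
  rewrite e -js_k inE => /orP[-> //|as_] _.
  by apply/residual_in/spanned_mem/map_f.
have [c [c0 ->]] := comb_positive tri kn (fun a ak => bounded_coefs_gt0 yk ak).
have collapse (b : nat -> R) : residual (map g s) (\sum_(a <- anc n) b a *: g a) =
    b j *: residual (map g s) (g j).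
  rewrite residual_sum (bigD1_seq j) ?anc_uniq //= residualZ big_seq_cond big1 ?addr0 //.
  by move=> a /andP[an aj]; rewrite residualZ residual_s // scaler0.
exists (c j / eta ^+ (n - j)).
  by rewrite divr_gt0 ?exprn_gt0 // c0 // -e.
rewrite -e /v /tilted !collapse scalerA divfK // expf_neq0 //.
by rewrite gt_eqF.
Qed.

(** Targets whose branch ends in n, approximated with the help of g_n.  Some ancestor
    is missing in s, for lack of room.  If it does not complete s to the optimal set,
    [exchange] leaves a margin and [tip_near] costs less.  Otherwise the residual of
    the target is c *: w with c > 0, and as g_n is eps *: 'X^n minus its tilted part,
    the contributions eps * y n and c * sqn w have opposite signs; [small] makes the
    second the larger one, so that the first only reduces the gain. *)
Lemma separates_newest_used s q y : q \in lineage n -> {in s, forall a, (a < n)%N} ->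
  (size s < size (lineage q))%N -> ~ n :: s =i lineage q -> bounded_coefs n y ->
  tail q n y + Num.min slack gain <= sqn (residual (g n :: map g s) (comb (lineage n) y)).
Proof.
move=> qn sn sz ne yn.
have szq : (size (lineage q) <= size (lineage n))%N.
  by apply: uniq_leq_size; [exact: lineage_uniq|move=> a; apply: lineage_trans].
have szn : (size s <= n)%N.
  by rewrite -ltnS (leq_trans sz) // (leq_trans szq) // lineage_size.
have xB := combB (ltnSn n) yn.
have y2 := slack_le_newest yn; have dd := slack_le; have dpos := d0.
have min1 : Num.min slack gain <= slack by rewrite ge_min lexx.
have min2 : Num.min slack gain <= gain by rewrite ge_min lexx orbT.
have [j miss] : exists j, last_missing s n j.
  case: (last_missing_or s n) => // sub; exfalso.
  move: qn; rewrite inE => /orP[/eqP qn|qn].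
    apply: ne => a; rewrite qn; have := uniq_min_size (anc_uniq n) sub.
    rewrite qn /= ltnS in sz; case=> // _ eq_s; by rewrite !inE eq_s.
  have [k kn e] := anc_parent qn; rewrite e in qn sub.
  have := uniq_leq_size (lineage_uniq q) (fun a aq => sub a (lineage_trans qn aq)).
  by rewrite leqNgt sz.
set x' := comb (anc n) y; have x'n : (size x' <= n)%N := comb_anc_size y.
have xE : comb (lineage n) y = y n *: 'X^n + x' := comb_parent y.
set w := residual (map g s) v.
have wn : (size w <= n)%N by apply: (residual_small tri sn); apply: tilted_size.
have Xw : ip 'X^n w = 0 by rewrite ipC ip_Xn_small.
have w_gt0 : 0 < sqn w by have [] := near sn szn miss.
have perturbed : (eps * y n - ip x' w) ^+ 2 / (eps ^+ 2 + sqn w) <=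
    ip x' w ^+ 2 / sqn w + slack.
  have XX : ip ('X^n : {poly R}) 'X^n = 1 by rewrite ipXn coefXn eqxx.
  have ipr : ip (comb (lineage n) y) (eps *: 'X^n - w) = eps * y n - ip x' w.
    by rewrite xE !ipE Xw XX (ip_Xn_small x'n); ring.
  have ipw : ip (comb (lineage n) y) w = ip x' w by rewrite xE !ipE Xw; ring.
  have := tip sn szn w_gt0 xB.
  by rewrite -/w (sqn_fresh eps eta tri sn) ipr ipw.
rewrite xE (sqn_residual_used tri gE sn) // -/v -/w.
have resid : 0 <= sqn (residual (map g s) x') - ip x' w ^+ 2 / sqn w.
  by rewrite -residual_cons sqn_ge0.
move: (qn); rewrite inE => /orP[/eqP qn'|qa].
  by rewrite qn' tail_self; lra.
have [k kn e] := anc_parent qa; rewrite e in qa.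
have yk := bounded_parent e yn.
rewrite (tail_parent _ e) //.
have [js_q|ne'] := pselect (j :: s =i lineage q); last first.
  have [_] := exchange kn qa sn sz yk miss ne'; rewrite -e -/x' -/w; lra.
(* As j completes s to the lineage of q, the parent k of n lies in it, hence q = k. *)
have kq : k \in lineage q.
  have [jn js jmax] := miss.
  have kn' : k \in anc n by rewrite e mem_head.
  rewrite -js_q inE; case: (boolP (k \in s)) => [_|ks]; first by rewrite orbT.
  by rewrite eqn_leq jmax // -ltnS ltnS lineage_le // -e.
have qk : q = k by apply/eqP; rewrite eqn_leq !lineage_le.
rewrite {q}qk in js_q sz qa kq qn ne szq *.
have [c c0 cE] := residual_aligned e kn sn miss js_q yk.
rewrite -e -/x' -/w in cE.
have xw : ip x' w = c * sqn w by rewrite -ip_residual cE ipZl.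
have Q : sqn (residual (map g s) x') = c ^+ 2 * sqn w by rewrite cE sqnZ.
have h1 := separates_fewer kn qa sn sz yk.
rewrite tail_self add0r -e -/x' Q in h1 *.
have [/andP[_ y_le] y_gt] : ((n.+1%:R)^-1 <= y n <= n.+1%:R) /\ 0 < y n.
  by split; [apply: yn|apply: (bounded_coefs_gt0 yn)]; rewrite mem_head.
have cw0 : 0 < c * sqn w by rewrite mulr_gt0.
have eyn : eps * y n <= eps * n.+1%:R by rewrite ler_pM2l.
have en0 : 0 <= eps * n.+1%:R by rewrite mulr_ge0 // ltW.
have ey : eps * y n <= c * sqn w.
  apply: (le_trans eyn); rewrite -(@ler_pXn2r _ 2) ?nnegrE ?(ltW cw0) //.
  apply: (le_trans (small sn szn w_gt0)); rewrite -/w.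
  by rewrite [X in _ <= X]exprMn [sqn w ^+ 2]expr2 mulrA ler_pM2r.
have ey0 : 0 <= eps * y n by rewrite mulr_ge0 // ltW.
have := @fresh_gain (c ^+ 2 * sqn w) 0 (sqn w) (sqn v) d (eps ^+ 2)
   ((eps * y n - ip x' w) ^+ 2).
rewrite exprn_gt0 // sqn_ge0 residual_contract d0 !add0r => h.
suff : gain <= c ^+ 2 * sqn w - (eps * y n - ip x' w) ^+ 2 / (eps ^+ 2 + sqn w) by lra.
apply: h => //; rewrite subr0 xw.
have -> : sqn w * (c ^+ 2 * sqn w) = (c * sqn w) ^+ 2 by ring.
move: (eps * y n) (c * sqn w) ey ey0 => a b ab a0.
have h2 : 0 <= a * (2 * b - a) by rewrite mulr_ge0 //; lra.
lra.
Qed.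

Lemma separates_succ : separates g n.+1 (Num.min slack gain).
Proof.
move=> p q s y; rewrite ltnS leq_eqVlt => pn qp sn sz ne yp.
have min1 : Num.min slack gain <= slack by rewrite ge_min lexx.
have min2 : Num.min slack gain <= gain by rewrite ge_min lexx orbT.
case: (boolP (n \in s)) => [ns|ns]; last first.
  have {}sn : {in s, forall a, (a < n)%N}.
    move=> a as_; have := sn a as_; rewrite ltnS leq_eqVlt => /orP[/eqP e|//].
    by rewrite -e as_ in ns.
  case/orP: pn => [/eqP e|pn].
    by rewrite e in qp yp *; have := separates_newest_unused qp sn sz ne yp; lra.
  have := sep pn qp sn sz ne yp; have := slack_le; have := d0; lra.
pose s' := [seq a <- s | a != n].
have s'n : {in s', forall a, (a < n)%N}.
  move=> a; rewrite mem_filter => /andP[an as_].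
  by have := sn a as_; rewrite ltnS leq_eqVlt (negbTE an).
have ss' : n :: s' =i s.
  by move=> a; rewrite inE mem_filter; case: eqP => [->|].
have sz' : (size s' < size (lineage q))%N.
  apply: leq_trans sz; rewrite size_filter -(count_predC (pred1 n) s).
  rewrite -[X in (X < _)%N]add0n ltn_add2r -has_count; apply/hasP.
  by exists n => //=; rewrite eqxx.
have ne' : ~ n :: s' =i lineage q by move=> h; apply: ne => a; rewrite -ss'.
apply: (@le_trans _ _ (sqn (residual (g n :: map g s') (comb (lineage p) y)))); last first.
  apply: residual_le => u /mapP[a as_ ->]; rewrite -map_cons.
  by apply/spanned_mem/map_f; rewrite ss'.
case/orP: pn => [/eqP e|pn].
  by rewrite e in qp yp *; apply: separates_newest_used.
by have := separates_old pn qp s'n sz' yp; lra.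
Qed.
End Separation.

(** The vectors at nodes below n are not changed by later choices. *)
Lemma map_agree g g' n s : (forall i, (i < n)%N -> g' i = g i) ->
  {in s, forall a, (a < n)%N} -> map g' s = map g s.
Proof. by move=> gg sn; apply/eq_in_map => a as_; apply/gg/sn. Qed.

Lemma tilted_agree g g' n m eta : (forall i, (i < n)%N -> g' i = g i) -> (m <= n)%N ->
  tilted g' m eta = tilted g m eta.
Proof.
move=> gg mn; apply: eq_big_seq => a am; rewrite gg //.
exact: leq_trans (anc_lt am) mn.
Qed.

Lemma triangular_agree g g' n : (forall i, (i < n)%N -> g' i = g i) ->
  triangular g n -> triangular g' n.
Proof.
move=> gg tri i i_n; have [eps [eta [e0 t0 gE]]] := tri i i_n.
by exists eps, eta; split=> //; rewrite gg // (tilted_agree _ gg) // ltnW.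
Qed.

Lemma separates_agree g g' n d : (forall i, (i < n)%N -> g' i = g i) ->
  separates g n d -> separates g' n d.
Proof.
by move=> gg sep p q s y pn qp sn sz ne yp; rewrite (map_agree gg sn); apply: sep.
Qed.

Definition separating g n := triangular g n /\ exists2 d, 0 < d & separates g n d.

Lemma separating_agree g g' n : (forall i, (i < n)%N -> g' i = g i) -> separating g n -> separating g' n.
Proof.
move=> gg [tri [d d0 sep]]; split; first exact: triangular_agree tri.
by exists d => //; apply: separates_agree sep.
Qed.

Definition update g n (h : {poly R}) i := if i == n then h else g i.

Lemma update_agree g n h i : (i < n)%N -> update g n h i = g i.
Proof. by rewrite /update; case: eqP => // ->; rewrite ltnn. Qed.

(** The order of the choices matters: eta is small in terms of the margin d, then
    eps in terms of d and of the finitely many residuals of the tilted vector. *)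
Lemma separating_extend g n : separating g n -> exists h, separating (update g n h) n.+1.
Proof.
move=> [tri [d d0 sep]].
have [B B0 hB] := comb_bounded n.+1.
have d20 : 0 < d / 2 by rewrite divr_gt0.
have [e1 e10 near] := tilted_near tri B0 d20.
pose eta := e1 / 2.
have eta0 : 0 < eta by rewrite divr_gt0.
have eta1 : eta < e1 by rewrite /eta; lra.
pose v := tilted g n eta.
pose slack := Num.min (d / 4) (2 * n.+1%:R ^+ 2)^-1.
have slack0 : 0 < slack.
  by rewrite lt_min divr_gt0 //= invr_gt0 mulr_gt0 // exprn_gt0.
have [e2 e20 tip] := tip_near g n v B0 slack0.
have [W W0 hW] := finite_lower_bound (fun s => sqn (residual (map g s) v)) n n.
pose K : R := n.+1%:R ^+ 2.
have K1 : 1 <= K by rewrite exprn_ege1 // ler1n.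
have K0 : 0 < K by lra.
pose e3 := Num.min 1 (d * W / K).
have e30 : 0 < e3 by rewrite lt_min ltr01 divr_gt0 // mulr_gt0.
pose eps := Num.min e2 e3 / 2.
have m0 : 0 < Num.min e2 e3 by rewrite lt_min e20.
have eps0 : 0 < eps by rewrite divr_gt0.
have epsm : eps < Num.min e2 e3 by rewrite ltr_pdivrMr // ltr_pMr ?ltr1n.
move: (epsm); rewrite lt_min => /andP[eps2 eps3].
move: eps3; rewrite lt_min => /andP[eps1 epsW].
set h := eps *: 'X^n - v; exists h.
have gg i : (i < n)%N -> update g n h i = g i by apply: update_agree.
have tri' := triangular_agree gg tri.
have sep' := separates_agree gg sep.
have vE : tilted (update g n h) n eta = v by rewrite (tilted_agree eta gg).
have gE : update g n h n = eps *: 'X^n - tilted (update g n h) n eta.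
  by rewrite vE /update eqxx.
split=> [i|].
  rewrite ltnS leq_eqVlt => /orP[/eqP->|i_n]; last exact: tri'.
  by exists eps, eta.
exists (Num.min slack (d * eps ^+ 2 / (eps ^+ 2 + sqn (tilted (update g n h) n eta)))).
  have e2_gt0 : 0 < eps ^+ 2 by rewrite exprn_gt0.
  have den : 0 < eps ^+ 2 + sqn (tilted (update g n h) n eta).
    by have := sqn_ge0 (tilted (update g n h) n eta); lra.
  by rewrite lt_min slack0 divr_gt0 // mulr_gt0.
apply: (separates_succ tri' eps0 eta0 d0 sep' gE hB).
- move=> s j sn sz miss; have [jn _ _] := miss.
  by rewrite vE (map_agree gg sn) gg ?anc_lt //; apply: near.
- by move=> s sn sz; rewrite vE (map_agree gg sn); apply: tip.
- move=> s sn sz; rewrite vE (map_agree gg sn) => w w_gt0.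
  have Ww := hW s sn sz w_gt0.
  rewrite exprMn -/K -ler_pdivlMr //.
  apply: (@le_trans _ _ (d * W / K)).
    apply: le_trans (ltW epsW); rewrite expr2 ler_piMr // ltW //.
  by rewrite ler_pM2r ?invr_gt0 // ler_pM2l.
Qed.

Theorem separating_sequence : exists g, forall n, separating g n.
Proof.
pose next g n := xget 0 [set h | separating (update g n h) n.+1]%classic.
pose F := fix F n : nat -> {poly R} :=
  if n is m.+1 then update (F m) m (next (F m) m) else fun=> 0.
have sep0 : separating (F 0) 0.
  by split=> //; exists 1 => // p q s y; rewrite ltn0.
have sepF n : separating (F n) n.
  elim: n => [//|n IH]; have [h hh] := separating_extend IH.
  exact: (@xgetPex _ 0 [set h | separating (update (F n) n h) n.+1]%classic (ex_intro _ h hh)).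
have stable n i : (i < n)%N -> F n i = F i.+1 i.
  elim: n => [//|n IH]; rewrite ltnS leq_eqVlt => /orP[/eqP->//|i_n].
  by rewrite /= update_agree // IH.
exists (fun i => F i.+1 i) => n; apply: separating_agree (sepF n) => i i_n.
by rewrite stable.
Qed.
End Induction.

(** * Following a branch adapted to given coordinates *)
Section Branch.
Variable R : realType.
Implicit Types (x : nat -> R).

Definition branch (b : nat -> nat) :=
  anc (b 0) = [::] /\ forall k, anc (b k.+1) = lineage (b k).

Definition partial (b : nat -> nat) x m : {poly R} := \sum_(k < m) x k *: 'X^(b k).

(** Late nodes have generous bounds, and each step of the branch can be taken as late
    as the next coordinate requires. *)
Lemma exists_branch x : (forall k, 0 < x k) ->
  exists2 b, branch b & forall k, ((b k).+1%:R)^-1 <= x k <= (b k).+1%:R.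
Proof.
move=> x0.
pose N k := maxn (Num.bound (x k)) (Num.bound (x k)^-1).
have ok k n : (N k <= n)%N -> (n.+1%:R)^-1 <= x k <= n.+1%:R.
  rewrite geq_max => /andP[n1 n2]; apply/andP; split; last first.
    apply: (le_trans (ltW (archi_boundP (ltW (x0 k))))); rewrite ler_nat; exact: leqW.
  rewrite -[x k]invrK lef_pV2 ?posrE ?invr_gt0 ?x0 //.
  have xV : 0 <= (x k)^-1 by rewrite invr_ge0 ltW.
  by apply: (le_trans (ltW (archi_boundP xV))); rewrite ler_nat; exact: leqW.
have root : exists n, (N 0%N <= n)%N /\ anc n = [::].
  by have [n] := root_above (N 0%N); exists n.
have child k a : exists n, (N k <= n)%N /\ anc n = lineage a.
  by have [n] := child_above a (N k); exists n.
pose c k a := xget 0%N [set n | (N k <= n)%N /\ anc n = lineage a]%classic.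
pose b := fix b k := if k is j.+1 then c j.+1 (b j)
  else xget 0%N [set n | (N 0%N <= n)%N /\ anc n = [::]]%classic.
have b0 : (N 0%N <= b 0%N)%N /\ anc (b 0%N) = [::].
  by have [n hn] := root; exact: (@xgetPex _ 0%N [set n | _]%classic (ex_intro _ n hn)).
have bS k : (N k.+1 <= b k.+1)%N /\ anc (b k.+1) = lineage (b k).
  have [n hn] := child k.+1 (b k).
  exact: (@xgetPex _ 0%N [set n | _]%classic (ex_intro _ n hn)).
exists b; first by split=> [|k]; [case: b0|case: (bS k)].
by case=> [|k]; apply: ok; [case: b0|case: (bS k)].
Qed.

Section Along.
Variables (b : nat -> nat) (x : nat -> R).
Hypothesis br : branch b.

Lemma branch_size k : size (anc (b k)) = k.
Proof. by case: br => b0 bS; elim: k => [|k IH]; rewrite ?b0 // bS /= IH. Qed.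

Lemma branch_mono k : (b k < b k.+1)%N.
Proof. by case: br => _ bS; apply: anc_lt; rewrite bS mem_head. Qed.

Lemma branch_mem i k : (i <= k)%N -> b i \in lineage (b k).
Proof.
case: br => _ bS; elim: k => [|k IH]; first by rewrite leqn0 => /eqP->; rewrite mem_head.
rewrite leq_eqVlt => /orP[/eqP->|/IH h]; first by rewrite mem_head.
by rewrite inE bS h orbT.
Qed.

(** The coordinates x read off at the nodes: b k has exactly k strict ancestors. *)
Definition branch_coord a := x (size (anc a)).

Lemma comb_branch k : comb (lineage (b k)) branch_coord = partial b x k.+1.
Proof.
case: br => b0 bS; elim: k => [|k IH].
  by rewrite /lineage b0 /comb big_seq1 /partial big_ord1 /branch_coord b0.
rewrite comb_cons bS IH /partial [RHS]big_ord_recr /= addrC.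
by rewrite {1}/branch_coord branch_size.
Qed.

Lemma tail_branch m k : (m <= k)%N ->
  tail (b m) (b k) branch_coord = \sum_(m.+1 <= i < k.+1) x i ^+ 2.
Proof.
case: br => b0 bS; elim: k => [|k IH].
  by rewrite leqn0 => /eqP->; rewrite tail_self big_geq.
rewrite leq_eqVlt => /orP[/eqP->|mk]; first by rewrite tail_self big_geq.
rewrite (tail_parent (k := b k) (n := b k.+1)) ?bS ?branch_mem //.
by rewrite IH // [RHS]big_nat_recr //= addrC {1}/branch_coord branch_size.
Qed.

Hypothesis x_bounded : forall k, ((b k).+1%:R)^-1 <= x k <= (b k).+1%:R.

Lemma lineage_branch k a : a \in lineage (b k) -> exists2 i, (i <= k)%N & a = b i.
Proof.
case: br => b0 bS; elim: k => [|k IH].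
  by rewrite inE b0 in_nil orbF => /eqP->; exists 0%N.
rewrite inE bS => /orP[/eqP->|/IH[i ik ->]]; first by exists k.+1.
by exists i => //; apply: leqW.
Qed.

Lemma branch_coord_bounded k : bounded_coefs (b k) branch_coord.
Proof. by move=> a /lineage_branch[i _ ->]; rewrite /branch_coord branch_size. Qed.

(** [separates] applied at a stage beyond the end of the branch and all of s.  If s is
    the optimal set itself, its vectors do not reach beyond b m. *)
Lemma partial_lower (g : nat -> {poly R}) s m M : (forall n, separating g n) ->
  (size s <= m.+1)%N ->
  \sum_(m.+1 <= i < M) x i ^+ 2 <= sqn (residual (map g s) (partial b x M)).
Proof.
move=> sepg sm; have [Mm|mM] := leqP M m.+1; first by rewrite big_geq ?sqn_ge0.
case: M mM => // k; rewrite ltnS => mk.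
rewrite -comb_branch -(tail_branch (ltnW mk)).
pose n := (maxn (b k) (\max_(a <- s) a)).+1.
have [tri [d d0 sep]] := sepg n.
have sn : {in s, forall a, (a < n)%N}.
  by move=> a as_; rewrite ltnS leq_max leq_bigmax_seq ?orbT.
have [e|ne] := pselect (s =i lineage (b m)); last first.
  apply: (@le_trans _ _ (tail (b m) (b k) branch_coord + d)); first by rewrite lerDl ltW.
  apply: sep => //; first by rewrite ltnS leq_maxl.
  - exact/branch_mem/ltnW.
  - by rewrite /= branch_size.
  - exact: branch_coord_bounded.
set X := comb _ _; rewrite -(subKr X (residual _ X)); apply: tail_le.
apply: (spanned_size (g := g) (s := s)); last exact: residual_spanned.
  by case: (sepg (b m).+1).
by move=> a; rewrite e ltnS; apply: lineage_le.
Qed.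

Lemma partial_spanned (g : nat -> {poly R}) i k : (forall n, separating g n) ->
  (i <= k.+1)%N -> spanned (map g (lineage (b k))) (partial b x i).
Proof.
move=> sepg; case: i => [_|i ik].
  by rewrite /partial big_ord0; apply: spanned0.
have [tri _] := sepg (b i).+1.
have [c [_ cE]] := comb_positive tri (ltnSn _)
  (fun a h => bounded_coefs_gt0 (@branch_coord_bounded i) h).
rewrite -comb_branch cE; apply: spanned_sum => a ai; apply/spannedZ/spanned_mem/map_f.
rewrite ltnS in ik; exact: lineage_trans (branch_mem ik) ai.
Qed.

Lemma sqn_partial m M : (m <= M)%N ->
  sqn (partial b x M - partial b x m) = \sum_(m <= i < M) x i ^+ 2.
Proof.
have b_lt i j : (i < j)%N -> (b i < b j)%N.
  elim: j => // j IH; rewrite ltnS leq_eqVlt => /orP[/eqP->|/IH h]; first exact: branch_mono.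
  exact: ltn_trans (branch_mono j).
elim: M => [|M IH].
  by rewrite leqn0 => /eqP->; rewrite subrr /sqn ip0r big_geq.
rewrite leq_eqVlt => /orP[/eqP->|mM]; first by rewrite subrr /sqn ip0r big_geq.
rewrite big_nat_recr //= -IH // /partial big_ord_recr /= addrAC sqnD_orth.
  by rewrite sqnZ /sqn ipXn coefXn eqxx mulr1.
rewrite ipZr ipXn; have -> : ((\sum_(k < M) x k *: 'X^(b k) - \sum_(k < m) x k *: 'X^(b k))`_(b M) = 0 :> R); last by rewrite mulr0.
have small j : (j <= M)%N -> (\sum_(k < j) x k *: 'X^(b k))`_(b M) = 0 :> R.
  move=> jM; rewrite coef_sum big1 // => i _; rewrite coefZ coefXn.
  by rewrite gtn_eqF ?mulr0 // b_lt // (leq_trans (ltn_ord i)).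
by rewrite coefB !small // subr0.
Qed.
End Along.

(** The statement about finitely supported sequences.  P M stands for the sum of
    x k *: 'X^(b k) over k < M: it is approximated by the m vectors at
    b 0, ..., b (m - 1) with error the tail of x, and by no m vectors better. *)
Theorem prescribed_tails : exists g : nat -> {poly R},
  [/\ forall n, 0 < sqn (g n),
      forall n, spanned (map g (lineage n)) 'X^n &
  forall x, (forall k, 0 < x k) -> exists P : nat -> {poly R},
   [/\ forall m M, (m <= M)%N -> sqn (P M - P m) = \sum_(m <= i < M) x i ^+ 2,
       P 0%N = 0,
       forall i m, (i <= m.+1)%N -> exists2 s, size s = m.+1 & spanned (map g s) (P i) &
       forall s m M, (size s <= m.+1)%N ->
         \sum_(m.+1 <= i < M) x i ^+ 2 <= sqn (residual (map g s) (P M))]].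
Proof.
have [g sepg] := separating_sequence R; exists g; split=> [n|n|x x0].
- have [tri _] := sepg n.+1; rewrite sqn_gt0; apply/eqP => g0.
  by have := triangular_coef tri (ltnSn n); rewrite g0 coef0 ltxx.
- have [tri _] := sepg n.+1; have [eps [eta [eps0 _ gE]]] := tri n (ltnSn n).
  have -> : 'X^n = eps^-1 *: (g n + tilted g n eta).
    by rewrite gE subrK scalerA mulVf ?scale1r ?gt_eqF.
  apply/spannedZ/spannedD; first by apply/spanned_mem/map_f/mem_head.
  by apply: spanned_sum => a an; apply/spannedZ/spanned_mem/map_f; rewrite inE an orbT.
have [b br xb] := exists_branch x0; exists (partial b x); split.
- exact: sqn_partial.
- by rewrite /partial big_ord0.
- move=> i m im; exists (lineage (b m)); first by rewrite /= branch_size.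
  exact: partial_spanned.
- by move=> s m M sm; apply: partial_lower.
Qed.
End Branch.

(** * Transfer to the Hilbert space *)
Section Sigma.
Variables (K : numFieldType) (H : lmodType K) (D : set H).

Lemma Sigma_add m k (x y : H) : Sigma_ D m x -> Sigma_ D k y -> Sigma_ D (m + k) (x + y).
Proof.
move=> [l [g [gD ->]]] [l' [g' [gD' ->]]].
exists (fun i : 'I_(m + k) => match fintype.split i with inl j => l j | inr j => l' j end).
exists (fun i : 'I_(m + k) => match fintype.split i with inl j => g j | inr j => g' j end).
split=> [i|]; first by case: (fintype.split i).
rewrite big_split_ord /=; congr (_ + _); apply: eq_bigr => i _.
  by rewrite (unsplitK (inl i)).
by rewrite (unsplitK (inr i)).
Qed.

Lemma Sigma_scale m a (x : H) : Sigma_ D m x -> Sigma_ D m (a *: x).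
Proof.
move=> [l [g [gD ->]]]; exists (fun i => a * l i), g; split=> //.
by rewrite scaler_sumr; apply: eq_bigr => i _; rewrite scalerA.
Qed.

Lemma Sigma_0 : Sigma_ D 0 0.
Proof.
by exists (fun=> 0), (fun=> 0); split=> [[]//|]; rewrite big_ord0.
Qed.

Lemma Sigma_1 a (g : H) : D g -> Sigma_ D 1 (a *: g).
Proof. by move=> Dg; exists (fun=> a), (fun=> g); split=> //; rewrite big_ord1. Qed.

Lemma linear_span_add (x y : H) : linear_span D x -> linear_span D y -> linear_span D (x + y).
Proof. by move=> [m _ xm] [k _ yk]; exists (m + k)%N => //; apply: Sigma_add. Qed.

Lemma linear_span_scale a (x : H) : linear_span D x -> linear_span D (a *: x).
Proof. by move=> [m _ xm]; exists m => //; apply: Sigma_scale. Qed.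

Lemma linear_span_0 : linear_span D 0.
Proof. by exists 0%N => //; apply: Sigma_0. Qed.
End Sigma.

Section Hilbert.
(* K is R or its complexification, with the inclusion iota, the real part re and the
   conjugation theta; both cases are treated at once. *)
Variables (R : realType) (K : numFieldType) (H : completeNormedModType K).
Variables (iota : {rmorphism R -> K}) (re : K -> R) (theta : K -> K).
Variable dot : H -> H -> K.
Hypothesis reD : forall a b, re (a + b) = re a + re b.
Hypothesis reM : forall r a, re (iota r * a) = r * re a.
Hypothesis re_iota : forall r, re (iota r) = r.
Hypothesis re_theta : forall a, re (theta a) = re a.
Hypothesis re_pos : forall a, 0 <= a -> 0 <= re a /\ iota (re a) = a.
Hypothesis iota_pos : forall r, (0 <= iota r) = (0 <= r).
Hypothesis theta_iota : forall r, theta (iota r) = iota r.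
Hypothesis dotDl : forall u v w, dot (u + v) w = dot u w + dot v w.
Hypothesis dotZl : forall a u v, dot (a *: u) v = a * dot u v.
Hypothesis dotDr : forall u v w, dot u (v + w) = dot u v + dot u w.
Hypothesis dotZr : forall a u v, dot u (a *: v) = theta a * dot u v.
Hypothesis dotC : forall u v, dot u v = theta (dot v u).
Hypothesis dotE : forall x, dot x x = `|x| ^+ 2.

Let dot0l v : dot 0 v = 0.
Proof. by have := dotZl 0 0 v; rewrite scale0r mul0r. Qed.
Let dot_suml (I : Type) (r : seq I) (F : I -> H) v :
  dot (\sum_(i <- r) F i) v = \sum_(i <- r) dot (F i) v.
Proof. exact: (big_morph (fun u => dot u v) (fun a b => dotDl a b v) (dot0l v)). Qed.
Let dot0r v : dot v 0 = 0.
Proof. by have := dotDr v 0 0; rewrite addr0 => /eqP; rewrite -subr_eq0 opprD addrA subrr sub0r oppr_eq0 => /eqP. Qed.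
Let dot_sumr (I : Type) (r : seq I) (F : I -> H) v :
  dot v (\sum_(i <- r) F i) = \sum_(i <- r) dot v (F i).
Proof. exact: (big_morph (dot v) (dotDr v) (dot0r v)). Qed.

Let re0 : re 0 = 0. Proof. by rewrite -(rmorph0 iota) re_iota. Qed.
Let reN a : re (- a) = - re a.
Proof. by have := reM (-1) a; rewrite rmorphN1 !mulN1r. Qed.
Let re_sum (I : Type) (r : seq I) (F : I -> K) :
  re (\sum_(i <- r) F i) = \sum_(i <- r) re (F i).
Proof. exact: (big_morph re reD re0). Qed.
Let re_le a b : a <= b -> re a <= re b.
Proof. by rewrite -subr_ge0 => /re_pos[+ _]; rewrite reD reN subr_ge0. Qed.

(** The norm of H takes its values in K; this is the same number as a real. *)
Definition rnorm (v : H) : R := re `|v|.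

Lemma rnormE v : `|v| = iota (rnorm v).
Proof. by have [_ ->] := re_pos (normr_ge0 v). Qed.
Lemma rnorm_ge0 v : 0 <= rnorm v.
Proof. by have [] := re_pos (normr_ge0 v). Qed.
Lemma rnormD u v : rnorm (u + v) <= rnorm u + rnorm v.
Proof. by rewrite /rnorm -reD; apply/re_le/ler_normD. Qed.
Lemma rnormB u v : rnorm (u - v) = rnorm (v - u).
Proof. by rewrite /rnorm distrC. Qed.
Lemma rnorm_sq v : rnorm v ^+ 2 = re (dot v v).
Proof. by rewrite dotE rnormE -rmorphXn re_iota. Qed.

(** H as a real inner product space, with the product re (dot u v). *)
Lemma rnorm_sq_add u v : re (dot u v) = 0 -> rnorm (u + v) ^+ 2 = rnorm u ^+ 2 + rnorm v ^+ 2.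
Proof.
move=> uv; rewrite !rnorm_sq dotDl !dotDr !reD (dotC v u) re_theta uv addr0 add0r //.
Qed.

Section Frame.
Implicit Types p q z : {poly R}.
Variable e : nat -> H.
Hypothesis orth : forall i j, dot (e i) (e j) = (i == j)%:R.

Definition embed (p : {poly R}) : H := \sum_(i < size p) iota p`_i *: e i.

Lemma embed_wide n p : (size p <= n)%N -> embed p = \sum_(i < n) iota p`_i *: e i.
Proof.
move=> pn; rewrite /embed (big_ord_widen n (fun i => iota p`_i *: e i)) //.
rewrite big_mkcond; apply: eq_bigr => i _; case: ltnP => // pi.
by rewrite nth_default // rmorph0 scale0r.
Qed.

Lemma embedD p q : embed (p + q) = embed p + embed q.
Proof.
pose n := maxn (size p) (size q).
rewrite !(@embed_wide n) ?leq_maxl ?leq_maxr ?size_polyD //.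
by rewrite -big_split; apply: eq_bigr => i _; rewrite coefD rmorphD scalerDl.
Qed.

Lemma embedZ a p : embed (a *: p) = iota a *: embed p.
Proof.
rewrite (embed_wide (size_scale_leq a p)) /embed scaler_sumr.
by apply: eq_bigr => i _; rewrite coefZ rmorphM scalerA.
Qed.

Lemma embed0 : embed 0 = 0. Proof. by rewrite /embed size_poly0 big_ord0. Qed.

Lemma embedB p q : embed (p - q) = embed p - embed q.
Proof. by rewrite -scaleN1r embedD embedZ rmorphN1 scaleN1r. Qed.

Lemma embed_sum (I : Type) (r : seq I) (F : I -> {poly R}) :
  embed (\sum_(i <- r) F i) = \sum_(i <- r) embed (F i).
Proof. exact: (big_morph _ embedD embed0). Qed.

Lemma embedXn n : embed 'X^n = e n.
Proof.
rewrite /embed size_polyXn big_ord_recr /= coefXn eqxx rmorph1 scale1r big1 ?add0r //.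
by move=> i _; rewrite coefXn ltn_eqF // rmorph0 scale0r.
Qed.

Lemma dot_embed p q : dot (embed p) (embed q) = iota (ip p q).
Proof.
pose n := maxn (size p) (size q).
rewrite (@embed_wide n p) ?leq_maxl // (@embed_wide n q) ?leq_maxr //.
rewrite (@ip_wide _ n) ?leq_maxl // rmorph_sum dot_suml; apply: eq_bigr => i _.
rewrite dot_sumr (bigD1 i) //= dotZl dotZr theta_iota orth eqxx mulr1 rmorphM.
rewrite big1 ?addr0 // => j ji.
rewrite -val_eqE /= in ji.
by rewrite dotZl dotZr orth eq_sym (negbTE ji) !mulr0.
Qed.

Lemma rnorm_embed p : rnorm (embed p) ^+ 2 = sqn p.
Proof. by rewrite rnorm_sq dot_embed re_iota. Qed.

Variable g : nat -> {poly R}.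
Hypothesis g_gt0 : forall n, 0 < sqn (g n).

Definition unit_of n : H := iota (Num.sqrt (sqn (g n)))^-1 *: embed (g n).
Definition frame_dictionary : set H := range unit_of.

Lemma unit_of_norm n : `|unit_of n| = 1.
Proof.
rewrite rnormE -(rmorph1 iota); congr (iota _).
apply/eqP; rewrite -(@eqrXn2 _ 2) ?rnorm_ge0 //.
rewrite /unit_of -embedZ rnorm_embed sqnZ exprVn sqr_sqrtr ?sqn_ge0 //.
by rewrite mulVf ?expr1n // gt_eqF.
Qed.

Lemma embed_unit n : embed (g n) = iota (Num.sqrt (sqn (g n))) *: unit_of n.
Proof.
rewrite /unit_of scalerA -rmorphM divff ?rmorph1 ?scale1r //.
by rewrite gt_eqF // sqrtr_gt0.
Qed.

Lemma Sigma_embed s p : spanned (map g s) p -> Sigma_ frame_dictionary (size s) (embed p).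
Proof.
elim: s p => [|a s IH] p /=; first by move=> ->; rewrite embed0; apply: Sigma_0.
case=> c /IH hp; rewrite -(subrK (c *: g a) p) embedD addrC embedZ embed_unit scalerA.
by rewrite -add1n; apply: Sigma_add => //; apply: Sigma_1; exists a.
Qed.

(** Subtract from y the combination with the real parts of the coefficients: what is
    left has purely imaginary coefficients, is orthogonal for re (dot u v) to all
    vectors with real coordinates, and can only increase the distance. *)
Lemma embed_lower m p y : Sigma_ frame_dictionary m y ->
  exists2 s, size s = m & sqn (residual (map g s) p) <= rnorm (embed p - y) ^+ 2.
Proof.
move=> [l [u [uD ->]]].
have [k kE] : exists k : 'I_m -> nat, forall i, unit_of (k i) = u i.
  have uD' i : exists k, unit_of k = u i by have [k _ <-] := uD i; exists k.
  by have [k hk] := choice uD'; exists k.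
exists (map k (enum 'I_m)); first by rewrite size_map size_enum_ord.
set s := map k _.
pose c i : R := (Num.sqrt (sqn (g (k i))))^-1.
pose z : {poly R} := \sum_(i < m) (re (l i) * c i) *: g (k i).
have zs : spanned (map g s) z.
  apply: spanned_sum => i _; apply/spannedZ/spanned_mem/map_f/map_f.
  by rewrite mem_enum.
have zE : embed z = \sum_(i < m) iota (re (l i)) *: u i.
  rewrite embed_sum; apply: eq_bigr => i _.
  by rewrite embedZ rmorphM -scalerA -kE.
apply: (le_trans (residual_min p zs)).
pose y' : H := \sum_(i < m) (l i - iota (re (l i))) *: u i.
have -> : embed p - \sum_(i < m) l i *: u i = embed (p - z) - y'.
  rewrite embedB zE -addrA -opprD -big_split; congr (_ - _).
  by apply: eq_bigr => i _; rewrite /= -scalerDl addrC subrK.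
rewrite rnorm_sq_add; first by rewrite rnorm_embed lerDl sqr_ge0.
have -> : - y' = iota (-1) *: y' by rewrite rmorphN1 scaleN1r.
rewrite dotZr theta_iota reM dot_sumr re_sum big1 ?mulr0 // => i _.
rewrite dotZr -kE /unit_of dotZr theta_iota dot_embed -rmorphM mulrC reM re_theta.
by rewrite reD reN re_iota subrr mulr0.
Qed.
End Frame.

(** * An orthonormal basis *)
Section GramSchmidt.
Definition coord_proj (l : seq H) (x : H) : H := \sum_(i < size l) dot x l`_i *: l`_i.
Definition orthonormal_seq (l : seq H) := forall i j,
  (i < size l)%N -> (j < size l)%N -> dot l`_i l`_j = (i == j)%:R.

Lemma dotBl u v w : dot (u - v) w = dot u w - dot v w.
Proof. by rewrite dotDl -scaleN1r dotZl mulN1r. Qed.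

Lemma coord_proj_orth l x j : orthonormal_seq l -> (j < size l)%N ->
  dot (x - coord_proj l x) l`_j = 0.
Proof.
move=> on jl; rewrite dotBl /coord_proj dot_suml (bigD1 (Ordinal jl)) //=.
rewrite dotZl on // eqxx mulr1 big1 ?addr0 ?subrr // => i ij.
by rewrite -val_eqE /= in ij; rewrite dotZl on // (negbTE ij) mulr0.
Qed.

Lemma coord_proj_min l x (c : nat -> K) : orthonormal_seq l ->
  rnorm (x - coord_proj l x) <= rnorm (x - \sum_(i < size l) c i *: l`_i).
Proof.
move=> on; rewrite -(@ler_pXn2r _ 2) ?nnegrE ?rnorm_ge0 //.
set z := \sum_(i < _) _; set r := x - _.
have -> : x - z = r + (coord_proj l x - z) by rewrite /r addrA subrK.
rewrite (@rnorm_sq_add r (coord_proj l x - z)) ?lerDl ?sqr_ge0 //.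
rewrite /coord_proj /z -sumrB dot_sumr re_sum big1 // => i _.
by rewrite -scalerBl dotZr coord_proj_orth // mulr0.
Qed.

Variable s : nat -> H.

(** Vectors of the sequence that depend on the previous ones are skipped. *)
Fixpoint gram_schmidt n : seq H :=
  if n is m.+1 then
    let l := gram_schmidt m in let r := s m - coord_proj l (s m) in
    if r == 0 then l else rcons l (`|r|^-1 *: r)
  else [::].

Lemma gram_schmidt_orthonormal n : orthonormal_seq (gram_schmidt n).
Proof.
elim: n => [|n IH] //=; case: ifP => // /negbT r0.
set l := gram_schmidt n in IH *; set r := s n - _ in r0 *.
have [_ nE] := re_pos (normr_ge0 r).
have n0 : `|r| != 0 by rewrite normr_eq0.
have last_orth i : (i < size l)%N -> dot (`|r|^-1 *: r) l`_i = 0.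
  by move=> il; rewrite dotZl coord_proj_orth ?mulr0.
have theta_inv : theta (`|r|^-1) = `|r|^-1 by rewrite -nE -fmorphV theta_iota.
have theta0 : theta 0 = 0 by rewrite -(rmorph0 iota) theta_iota.
move=> i j; rewrite size_rcons !ltnS !nth_rcons.
rewrite leq_eqVlt => /orP[/eqP->|il]; rewrite leq_eqVlt => /orP[/eqP->|jl].
- rewrite !ltnn !eqxx dotZl dotZr dotE theta_inv.
  by rewrite mulrA -invfM -expr2 mulVf // expf_neq0.
- by rewrite ltnn eqxx jl last_orth // gtn_eqF.
- by rewrite ltnn eqxx il dotC last_orth // ltn_eqF // theta0.
- by rewrite il jl IH.
Qed.

Lemma gram_schmidt_prefix n m : (n <= m)%N ->
  exists l, gram_schmidt m = gram_schmidt n ++ l.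
Proof.
elim: m => [|m IH]; first by rewrite leqn0 => /eqP->; exists [::].
rewrite leq_eqVlt => /orP[/eqP->|/IH[l e]]; first by exists [::]; rewrite cats0.
rewrite [gram_schmidt m.+1]/=; case: ifP => _; first by exists l.
by exists (rcons l (`|s m - coord_proj (gram_schmidt m) (s m)|^-1 *:
  (s m - coord_proj (gram_schmidt m) (s m)))); rewrite -rcons_cat -e.
Qed.

Lemma gram_schmidt_span n : exists c : nat -> K,
  s n = \sum_(i < size (gram_schmidt n.+1)) c i *: (gram_schmidt n.+1)`_i.
Proof.
rewrite /=; set l := gram_schmidt n; set r := s n - _; case: ifP => [/eqP r0|/negbT r0].
  by exists (fun i => dot (s n) l`_i); apply/eqP; rewrite -subr_eq0; apply/eqP.
exists (fun i => if (i < size l)%N then dot (s n) l`_i else `|r|).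
rewrite size_rcons big_ord_recr /= ltnn nth_rcons ltnn eqxx scalerA.
rewrite divff ?normr_eq0 // scale1r.
rewrite -[LHS](subrK (coord_proj l (s n))) addrC; congr (_ + _).
by apply: eq_bigr => i _; rewrite nth_rcons ltn_ord.
Qed.

Hypothesis infdim : infinite_dimensional H.
Hypothesis dense_s : forall x (r : R), 0 < r -> exists n, rnorm (x - s n) < r.

(** If the process stopped, the whole dense sequence would lie in the span of finitely
    many orthonormal vectors, and so would its limits, since the orthogonal
    projection is the nearest point. *)
Lemma gram_schmidt_unbounded k : exists n, (k < size (gram_schmidt n))%N.
Proof.
apply: contrapT => /forallNP small.
have {}small n : (size (gram_schmidt n) <= k)%N by rewrite leqNgt; apply/negP.
have ex : exists m, `[< exists n, size (gram_schmidt n) = m >].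
  by exists 0%N; apply/asboolP; exists 0%N.
have ub m : `[< exists n, size (gram_schmidt n) = m >] -> (m <= k)%N.
  by move/asboolP => [n <-].
case: (ex_maxnP ex ub) => m /asboolP[N Nm] mmax.
set l := gram_schmidt N.
have grow n : exists l', l = gram_schmidt n ++ l'.
  have [nN|Nn] := leqP n N; first exact: gram_schmidt_prefix.
  have [l' e] := gram_schmidt_prefix (ltnW Nn).
  have : (size (gram_schmidt n) <= m)%N by apply: mmax; apply/asboolP; exists n.
  rewrite e size_cat Nm -[X in (_ <= X)%N]addn0 leq_add2l leqn0 size_eq0 => /eqP l0.
  by exists [::]; rewrite l0 !cats0.
have on := @gram_schmidt_orthonormal N; rewrite -/l in on.
apply: infdim; exists (size l), (fun i => l`_i) => x.
exists (fun i => dot x l`_i); apply/eqP; rewrite -subr_eq0 -normr_eq0 rnormE fmorph_eq0.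
rewrite eq_le rnorm_ge0 andbT; apply/ler_addgt0Pl => r r0; rewrite addr0.
have [n nr] := dense_s x r0; apply: le_trans (ltW nr).
have [c cE] := gram_schmidt_span n; have [l' lE] := grow n.+1.
pose c' i := if (i < size (gram_schmidt n.+1))%N then c i else 0.
have -> : s n = \sum_(i < size l) c' i *: l`_i; last exact: coord_proj_min.
rewrite cE lE size_cat big_split_ord /= [X in _ = _ + X]big1 ?addr0.
  by apply: eq_bigr => i _; rewrite /c' ltn_ord nth_cat ltn_ord.
by move=> i _; rewrite /c' ltnNge leq_addr scale0r.
Qed.

Lemma exists_frame : exists e : nat -> H,
  (forall i j, dot (e i) (e j) = (i == j)%:R) /\
  forall n, exists m (c : nat -> K), s n = \sum_(i < m) c i *: e i.
Proof.
have [N NP] := choice gram_schmidt_unbounded.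
pose e k := (gram_schmidt (N k))`_k.
have eE n k : (k < size (gram_schmidt n))%N -> e k = (gram_schmidt n)`_k.
  move=> kn; rewrite /e; have [h|/ltnW h] := leqP n (N k).
    by have [l ->] := gram_schmidt_prefix h; rewrite nth_cat kn.
  by have [l ->] := gram_schmidt_prefix h; rewrite nth_cat NP.
exists e; split=> [i j|n]; last first.
  have [c cE] := gram_schmidt_span n.
  exists (size (gram_schmidt n.+1)), c; rewrite {1}cE.
  by apply: eq_bigr => i _; rewrite (eE n.+1).
pose M := maxn (N i) (N j).
have sz k : (N k <= M)%N -> (k < size (gram_schmidt M))%N.
  move=> h; have [l ->] := gram_schmidt_prefix h.
  by rewrite size_cat ltn_addr.
rewrite (eE M) ?(eE M j) ?sz ?leq_maxl ?leq_maxr //.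
by apply: gram_schmidt_orthonormal; rewrite sz ?leq_maxl ?leq_maxr.
Qed.
End GramSchmidt.

(** * Prescribed deviations *)
Lemma iota_lt a b : (iota a < iota b) = (a < b).
Proof. by rewrite !lt_neqAle (inj_eq (fmorph_inj iota)) -subr_ge0 -rmorphB iota_pos subr_ge0. Qed.

Lemma iota_le a b : (iota a <= iota b) = (a <= b).
Proof. by rewrite -subr_ge0 -rmorphB iota_pos subr_ge0. Qed.

Lemma iota_surj (k : K) : 0 < k -> exists2 r, 0 < r & k = iota r.
Proof.
move=> k0; have [_ kE] := re_pos (ltW k0); exists (re k) => //.
by rewrite -iota_lt rmorph0 kE.
Qed.

(** The order of K need not be total; an attained lower bound is a greatest lower
    bound nevertheless. *)
Lemma dist_to_attained (A : set H) v r : (forall y, A y -> r <= rnorm (v - y)) ->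
  (exists2 y, A y & rnorm (v - y) = r) -> dist_to v A = iota r.
Proof.
move=> low [y Ay yr]; rewrite /dist_to /infimum.
set S := [set _ | _ in _].
have Sr : S (iota r) by exists y => //; rewrite rnormE yr.
have inf_r : infimums S (iota r).
  split=> [_ [z Az <-]|a]; first by rewrite rnormE iota_le low.
  by move/(_ _ Sr).
case: ifPn => [/eqP S0|_]; first by rewrite S0 in Sr.
have [lowS upS] := xgetPex 0 (ex_intro _ _ inf_r).
apply/le_anti; rewrite (lowS _ Sr) /=.
by apply: upS; case: inf_r.
Qed.

Lemma separable_sequence : separable_space H ->
  exists s : nat -> H, forall x (r : R), 0 < r -> exists n, rnorm (x - s n) < r.
Proof.
move=> [S /countable_injP[f finj] dS].
exists (fun n => xget 0 [set x | S x /\ f x = n]) => x r r0.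
have [|z [xz Sz]] := dS (ball x (iota r)) _ (ball_open _ _).
  by exists x; apply: ballxx; rewrite -(rmorph0 iota) iota_lt.
exists (f z).
have [Sz' fz'] := xgetPex (P := [set x | S x /\ f x = f z]) 0 (ex_intro _ z (conj Sz erefl)).
have -> : xget 0 [set x | S x /\ f x = f z] = z by apply: finj; rewrite ?inE.
by move: xz; rewrite -ball_normE /= rnormE iota_lt.
Qed.

Section Realize.
Variables (e : nat -> H) (g : nat -> {poly R}).
Hypothesis orth : forall i j, dot (e i) (e j) = (i == j)%:R.
Hypothesis g_gt0 : forall n, 0 < sqn (g n).
Let D := frame_dictionary e g.
Variables (d x : nat -> R) (P : nat -> {poly R}).
Hypothesis d_ge0 : forall n, 0 <= d n.
Hypothesis P_diff : forall m M, (m <= M)%N -> sqn (P M - P m) = \sum_(m <= i < M) x i ^+ 2.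
Hypothesis P0 : P 0%N = 0.
Hypothesis P_span : forall i m, (i <= m.+1)%N ->
  exists2 s, size s = m.+1 & spanned (map g s) (P i).
Hypothesis P_lower : forall s m M, (size s <= m.+1)%N ->
  \sum_(m.+1 <= i < M) x i ^+ 2 <= sqn (residual (map g s) (P M)).
Hypothesis x_drop : forall i, d i.+1 < d i -> x i ^+ 2 = d i ^+ 2 - d i.+1 ^+ 2.

Definition drops M := forall i, (i < M)%N -> d i.+1 < d i.

Lemma sum_drops m M : drops M -> (m <= M)%N ->
  \sum_(m <= i < M) x i ^+ 2 = d m ^+ 2 - d M ^+ 2.
Proof.
move=> dr mM; rewrite -opprB -(telescope_sumr (fun i => d i ^+ 2) mM) -sumrN.
by apply: eq_big_nat => i /andP[_ iM]; rewrite x_drop ?dr // opprB.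
Qed.

Lemma P_Sigma i m : (i <= m)%N -> Sigma_ D m (embed e (P i)).
Proof.
case: m => [|m] im.
  by move: im; rewrite leqn0 => /eqP->; rewrite P0 embed0; apply: Sigma_0.
by have [s <- hs] := P_span im; apply: Sigma_embed.
Qed.

Lemma rnorm_P_diff m M : drops M -> (m <= M)%N ->
  rnorm (embed e (P M) - embed e (P m)) ^+ 2 = d m ^+ 2 - d M ^+ 2.
Proof.
by move=> dr mM; rewrite -embedB (rnorm_embed orth) P_diff // sum_drops.
Qed.

Lemma rnorm_P_le m M : drops M -> (m <= M)%N ->
  rnorm (embed e (P M) - embed e (P m)) <= d m.
Proof.
move=> dr mM; rewrite -(@ler_pXn2r _ 2) ?nnegrE ?rnorm_ge0 //.
by rewrite rnorm_P_diff // gerBl sqr_ge0.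
Qed.

Lemma rnorm_P_lower m M y : drops M -> (m <= M)%N -> Sigma_ D m y ->
  d m - d M <= rnorm (embed e (P M) - y).
Proof.
move=> dr mM my.
have low : d m ^+ 2 - d M ^+ 2 <= rnorm (embed e (P M) - y) ^+ 2.
  case: m mM my => [|m] mM my; last first.
    have [s sm hs] := embed_lower orth (P M) my; apply: le_trans hs.
    by rewrite -sum_drops //; apply: P_lower; rewrite sm.
  have -> : y = embed e (P 0%N).
    by case: my => l [h [_ ->]]; rewrite big_ord0 P0 embed0.
  by rewrite rnorm_P_diff.
have dd : d M <= d m.
  elim: M dr mM {low} => [|M IH] dr; first by rewrite leqn0 => /eqP->.
  rewrite leq_eqVlt => /orP[/eqP->//|mM].
  apply: le_trans (ltW (dr M (ltnSn _))) _; apply: IH => // i iM.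
  by apply: dr; apply: ltnW.
have h0 : 0 <= d m - d M by rewrite subr_ge0.
rewrite -(@ler_pXn2r _ 2) ?nnegrE ?rnorm_ge0 //; apply: le_trans low.
have : 0 <= d M * (d m - d M) by rewrite mulr_ge0.
lra.
Qed.

(** The deviations of v are the limits of those of the partial sums: the vector
    embedded from P m attains d m up to the error of the approximation, and no
    competitor goes below d m by more than that error. *)
Lemma sigma_realized v m :
  (forall r, 0 < r -> exists M, [/\ drops M, (m <= M)%N,
     rnorm (v - embed e (P M)) <= r & d M <= r]) ->
  sigma_ D m v = iota (d m).
Proof.
move=> approx.
have low y : Sigma_ D m y -> d m <= rnorm (v - y).
  move=> my; apply/ler_addgt0Pl => r r0.
  have [M [dr mM vM dM]] := approx (r / 2) (divr_gt0 r0 (ltr0Sn _ _)).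
  have h1 := rnorm_P_lower dr mM my.
  have h2 := rnormD (embed e (P M) - v) (v - y).
  rewrite addrA subrK (rnormB _ v) in h2; lra.
have att : rnorm (v - embed e (P m)) = d m.
  apply/le_anti; rewrite low ?andbT; last exact: P_Sigma.
  apply/ler_addgt0Pl => r r0; have [M [dr mM vM _]] := approx r r0.
  have h1 := rnormD (v - embed e (P M)) (embed e (P M) - embed e (P m)).
  rewrite addrA subrK in h1; apply: le_trans h1 _.
  by rewrite lerD // rnorm_P_le.
case: m approx low att => [|m] approx low att.
  by rewrite /sigma_ rnormE -att P0 embed0 subr0.
by apply: dist_to_attained => //; exists (embed e (P m.+1)) => //; apply: P_Sigma.
Qed.

Hypothesis d_cvg : d @ \oo --> 0.

Lemma d_small r : 0 < r -> exists N, forall n, (N <= n)%N -> d n < r.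
Proof.
move=> r0; have /cvgrPdist_lt/(_ r r0)[N _ hN] := d_cvg.
exists N => n /hN /=; by rewrite sub0r normrN ger0_norm.
Qed.

(** The partial sums form a Cauchy sequence because their distances are bounded by d. *)
Lemma realize_infinite : strictly_monotonic d ->
  exists v, forall m, sigma_ D m v = iota (d m).
Proof.
move=> mono; have dr M : drops M by move=> i _; apply: mono.
pose X n := embed e (P n).
have cX : cvg (X @ \oo).
  apply: cauchy_cvg; apply: cauchy_exP => eps /iota_surj[r r0 ->].
  have [N hN] := d_small r0; exists (X N), N => // n /= Nn.
  rewrite -ball_normE /= rnormE iota_lt rnormB.
  exact: le_lt_trans (rnorm_P_le (dr _) Nn) (hN N (leqnn N)).
have [v Xv] := (cvg_ex _).1 cX.
have close M : rnorm (v - X M) <= d M.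
  apply/ler_addgt0Pl => r r0.
  have ir0 : 0 < iota r by rewrite -(rmorph0 iota) iota_lt.
  have /cvgrPdist_lt/(_ _ ir0)[N _ hN] := Xv.
  have := hN (maxn N M) (leq_maxl _ _); rewrite /= rnormE iota_lt => h1.
  have h2 := rnorm_P_le (dr _) (leq_maxr N M).
  have h3 := rnormD (v - X (maxn N M)) (X (maxn N M) - X M).
  rewrite addrA subrK in h3; apply: le_trans h3 _.
  by rewrite lerD // ltW.
exists v => m; apply: sigma_realized => r r0.
have [N hN] := d_small r0; have := hN (maxn m N) (leq_maxr _ _) => /ltW dN.
exists (maxn m N); split=> //; first exact: leq_maxl.
exact: le_trans (close _) dN.
Qed.

(** The partial sum of length N realises d: it lies in all sets Sigma_ of order at
    least N, and for smaller orders [sigma_realized] applies with error 0. *)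
Lemma realize_finite : strictly_monotonic_to_zero d ->
  exists v, forall m, sigma_ D m v = iota (d m).
Proof.
move=> [N [dr dN]]; exists (embed e (P N)) => m.
have rnorm0 : rnorm 0 = 0 by rewrite /rnorm normr0 -(rmorph0 iota) re_iota.
have [mN|Nm] := leqP m N.
  apply: sigma_realized => r r0; exists N; split=> //.
    by rewrite subrr rnorm0 ltW.
  by rewrite dN // ltW.
case: m Nm => // m Nm; rewrite dN; last exact: ltnW.
apply: dist_to_attained => [y _|]; first exact: rnorm_ge0.
exists (embed e (P N)); first by apply: P_Sigma; apply: ltnW.
by rewrite subrr rnorm0.
Qed.
End Realize.

(** The coordinates are the square roots of the drops of the squares of d.  Where d is
    constantly 0 they are replaced by 1, so that one branch serves both types of
    sequences. *)
Theorem prescribed_deviations : separable_space H -> infinite_dimensional H ->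
  exists D : set H, dictionary D /\
    forall d : nat -> R, d @ \oo --> 0 ->
      strictly_monotonic d \/ strictly_monotonic_to_zero d ->
      exists x : H, forall m : nat, sigma_ D m x = iota (d m).
Proof.
move=> /separable_sequence[s dense_s] infdim.
have [e [orth s_span]] := exists_frame infdim dense_s.
have [g [g_gt0 Xn_span branches]] := prescribed_tails R.
exists (frame_dictionary e g); split.
  split=> [_ [n _ <-]|]; first exact: unit_of_norm.
  apply/seteqP; split=> // x _ B /nbhs_ballP[eps /= /iota_surj[r r0 ->] xB].
  have [n xn] := dense_s x r r0; exists (s n); split; last first.
    by apply: xB; rewrite -ball_normE /= rnormE iota_lt.
  have [m [c ->]] := s_span n.
  apply: big_ind => [||i _]; [exact: linear_span_0|exact: linear_span_add|].
  apply: linear_span_scale; rewrite -embedXn.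
  by exists (size (lineage i)) => //; apply: Sigma_embed.
move=> d d_cvg d_mono.
have d_le n : d n.+1 <= d n.
  case: d_mono => [/(_ n)/ltW //|[N [dlt d0]]].
  have [/dlt/ltW //|Nn] := ltnP n N; by rewrite !d0 // leqW.
have d_ge0 n : 0 <= d n.
  rewrite -(cvg_lim _ d_cvg) //; apply: nonincreasing_cvgn_ge; last by apply: cvgP d_cvg.
  exact/nonincreasing_seqP.
pose x i : R := if d i.+1 < d i then Num.sqrt (d i ^+ 2 - d i.+1 ^+ 2) else 1.
have drop_gt0 i : d i.+1 < d i -> 0 < d i ^+ 2 - d i.+1 ^+ 2.
  by move=> h; rewrite subr_gt0 ltr_pXn2r ?nnegrE.
have x_gt0 i : 0 < x i by rewrite /x; case: ifP => // /drop_gt0; rewrite sqrtr_gt0.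
have x_drop i : d i.+1 < d i -> x i ^+ 2 = d i ^+ 2 - d i.+1 ^+ 2.
  by move=> h; rewrite /x h sqr_sqrtr // ltW // drop_gt0.
have [P [P_diff P0 P_span P_lower]] := branches x x_gt0.
case: d_mono => mono.
  exact: (realize_infinite orth g_gt0 d_ge0 P_diff P0 P_span P_lower x_drop d_cvg mono).
exact: (realize_finite orth g_gt0 d_ge0 P_diff P0 P_span P_lower x_drop mono).
Qed.
End Hilbert.

Local Open Scope complex_scope.

Theorem theorem3 (R : realType) :
  (forall (H : completeNormedModType R) (dot : {dot H for idfun}),
     (forall x : H, dot x x = `|x| ^+ 2) ->
     separable_space H -> infinite_dimensional H ->
     exists D : set H, dictionary D /\
       forall d : nat -> R, d @ \oo --> 0 ->
         strictly_monotonic d \/ strictly_monotonic_to_zero d ->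
         exists x : H, forall m : nat, sigma_ D m x = d m)
  /\
  (forall (H : completeNormedModType R[i]) (dot : {dot H for Num.conj}),
     (forall x : H, dot x x = `|x| ^+ 2) ->
     separable_space H -> infinite_dimensional H ->
     exists D : set H, dictionary D /\
       forall d : nat -> R, d @ \oo --> 0 ->
         strictly_monotonic d \/ strictly_monotonic_to_zero d ->
         exists x : H, forall m : nat, sigma_ D m x = (d m)%:C).
Proof.
split=> H dot dotE sep infdim.
  apply: (@prescribed_deviations R R H idfun idfun idfun dot) => //.
  - by move=> u v w; rewrite linearDl.
  - by move=> a u v; rewrite linearZl_LR.
  - by move=> u v w; rewrite linearDr.
  - by move=> a u v; rewrite linearZr_LR.
  - by move=> u v; rewrite hermC expr0 mul1r.
have reD (a b : R[i]) : complex.Re (a + b) = complex.Re a + complex.Re b.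
  by case: a b => [? ?] [? ?].
apply: (@prescribed_deviations R R[i] H (real_complex R) (@complex.Re R) Num.conj dot) => //.
- by move=> r [a b] /=; rewrite mul0r subr0.
- by case.
- by case=> a b; rewrite lecE /= => /andP[/eqP -> a0].
- by move=> r; rewrite -[0]/(0%:C) lecR.
- by move=> r; rewrite conj_Creal // complex_real.
- by move=> u v w; rewrite linearDl.
- by move=> a u v; rewrite linearZl_LR.
- by move=> u v w; rewrite linearDr.
- by move=> a u v; rewrite linearZr_LR.
- by move=> u v; rewrite hermC expr0 mul1r.
Qed.
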